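(* Let $d\geq 2$, let $A\subset\mathbb{R}^d$ have positive reach and let $a\in T_1^+(A)$. Then there exist a $1$-dimensional $C^{1,1}$ surface $\Gamma$ and $\delta>0$ such that $$T_1(A)\cap B(a,\delta)\subset\Gamma\cap B(a,\delta)\subset A.$$
   Context: A set $A\subset\mathbb{R}^d$ has positive reach if there is $\varepsilon>0$ such that every $x$ with $\mathrm{dist}(x,A)<\varepsilon$ has a unique nearest point in $A$. $\operatorname{Tan}(A,x)$ is the tangent cone ($u\in\operatorname{Tan}(A,x)$ iff $u=0$ or $r_i(x_i-x)\to u$ for some $x\neq x_i\in A$, $x_i\to x$, $r_i>0$). $T_1(A)$ is the set of $x\in A$ with $\dim\operatorname{span}\operatorname{Tan}(A,x)=1$, and $T_1^+(A)$ is the set of $x\in T_1(A)$ for which $\operatorname{Tan}(A,x)=\operatorname{span}\operatorname{Tan}(A,x)$ (i.e. the tangent cone is a full line). A $1$-dimensional $C^{1,1}$ surface is a set $\{w+\varphi(w):w\in W\}$ with $W$ a one-dimensional linear subspace and $\varphi:W\to W^\perp$ differentiable with Lipschitz derivative. *)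

(* Defs.v *)
From HB Require Import structures.
From mathcomp Require Import all_boot all_order all_algebra.
From mathcomp Require Import all_classical all_reals all_analysis.
Set Implicit Arguments. Unset Strict Implicit. Unset Printing Implicit Defensive.
Import Order.TTheory GRing.Theory Num.Theory.
Import numFieldNormedType.Exports.
Local Open Scope classical_set_scope.
Local Open Scope ring_scope.

Section Defs.
Variables (R : realType) (d : nat).
Notation V := 'rV[R]_d.

Definition edot (u v : V) : R := \sum_(i < d) u 0 i * v 0 i.
Definition enorm (u : V) : R := Num.sqrt (edot u u).

Definition eball (a : V) (r : R) : set V := [set x | enorm (x - a) < r].

Definition nearest (A : set V) (x p : V) : Prop :=
  A p /\ forall q, A q -> enorm (x - p) <= enorm (x - q).

(* positive reach: some eps > 0 s.t. every x with dist(x,A) < eps has a unique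
   nearest point in A.  dist(x,A) < eps  <=>  some point of A is at distance < eps. *)
Definition positive_reach (A : set V) : Prop :=
  exists eps : R, 0 < eps /\
    forall x : V, (exists y, A y /\ enorm (x - y) < eps) ->
      exists p, nearest A x p /\ forall p', nearest A x p' -> p' = p.

Definition Tan (A : set V) (x : V) : set V :=
  [set u : V | u = 0 \/
    exists (xs : nat -> V) (r : nat -> R),
      (forall i, A (xs i) /\ xs i != x /\ 0 < r i) /\
      xs @ \oo --> x /\
      (fun i => r i *: (xs i - x)) @ \oo --> u].

Definition span (S : set V) : set V :=
  [set v | exists (n : nat) (c : 'I_n -> R) (s : 'I_n -> V),
      (forall i, S (s i)) /\ v = \sum_(i < n) c i *: s i].

Definition line (w : V) : set V := [set t *: w | t in [set: R]].

Definition dim_span_eq1 (S : set V) : Prop :=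
  exists w : V, w != 0 /\ span S = line w.

Definition T1 (A : set V) : set V :=
  [set x | A x /\ dim_span_eq1 (Tan A x)].

Definition T1plus (A : set V) : set V :=
  [set x | T1 A x /\ Tan A x = span (Tan A x)].

(* 1-dimensional C^{1,1} surface { w' + phi(w') : w' in W }, W = R w with |w| = 1,
   parametrized isometrically by t |-> t w: phi(t w) = psi t, psi t in W^perp,
   psi differentiable with Lipschitz derivative. *)
Definition C11_surface1 (G : set V) : Prop :=
  exists (w : V) (psi : R -> V),
    enorm w = 1 /\
    (forall t, edot (psi t) w = 0) /\
    (forall t, derivable psi t 1) /\
    (exists L : R, forall s t, enorm (derive1 psi s - derive1 psi t) <= L * `|s - t|) /\
    G = [set t *: w + psi t | t in [set: R]].

End Defs.

(* Main.v *)
(* Fix 0 < r less than the reach of A. Maximising dist(y, A) - lam |y - x| over a ball around x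
   shows that, when p is the point of A nearest to x, the ball of radius r touching A at p from
   the side of x has no point of A inside: 2r <x - p, q - p> <= |x - p| |q - p|^2 for q in A.
   Hence the point of A nearest to the midpoint of b, c in A is at distance O(|b - c|^2), and at
   a point whose tangent cone lies in a line, A is squeezed between the parabolas around it.

   Now join two points of A on either side of a by a chain of N steps in A of minimal energy
   (the sum of the squared steps). Every inner vertex is the point of A nearest to the midpoint
   of its neighbours, so the second differences are bounded by the squared steps; the energy
   being O(1/N) by repeated bisection, the steps are nearly constant and the second differences
   are O(1/N^2). A limit of these chains along an ultrafilter is a C^{1,1} graph contained in A
   over a neighbourhood of a in the tangent line at a. A point of T_1(A) near a is the only point
   of A near a in its hyperplane orthogonal to that line, because of the parabolas at it and
   at a; so it lies on the curve. *)

Require Import Defs.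
From HB Require Import structures.
From mathcomp Require Import all_boot all_order all_algebra.
From mathcomp Require Import all_classical all_reals all_analysis.
From mathcomp Require Import ring lra.
Set Implicit Arguments. Unset Strict Implicit. Unset Printing Implicit Defensive.
Import Order.TTheory GRing.Theory Num.Theory.
Import numFieldNormedType.Exports.
Local Open Scope classical_set_scope.
Local Open Scope ring_scope.

(** * Euclidean space *)

Section Euclid.
Variables (R : realType) (d : nat).
Implicit Types (u v w x y z : 'rV[R]_d) (k : R).

Lemma edotC u v : edot u v = edot v u.
Proof. by apply: eq_bigr => i _; rewrite mulrC. Qed.

Lemma edotDl u v w : edot (u + v) w = edot u w + edot v w.
Proof. by rewrite -big_split; apply: eq_bigr => i _; rewrite mxE mulrDl. Qed.

Lemma edotZl k u v : edot (k *: u) v = k * edot u v.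
Proof. by rewrite /edot big_distrr; apply: eq_bigr => i _ /=; rewrite mxE mulrA. Qed.

Lemma edotNl u v : edot (- u) v = - edot u v.
Proof. by rewrite -scaleN1r edotZl mulN1r. Qed.

Lemma edotDr u v w : edot w (u + v) = edot w u + edot w v.
Proof. by rewrite edotC edotDl !(edotC w). Qed.

Lemma edotZr k u v : edot u (k *: v) = k * edot u v.
Proof. by rewrite edotC edotZl edotC. Qed.

Lemma edotNr u v : edot u (- v) = - edot u v.
Proof. by rewrite edotC edotNl edotC. Qed.

Lemma edot0l u : edot 0 u = 0.
Proof. by rewrite -(scale0r 0) edotZl mul0r. Qed.

Lemma edot0r u : edot u 0 = 0.
Proof. by rewrite edotC edot0l. Qed.

Definition edotE := (edotDl, edotDr, edotNl, edotNr, edotZl, edotZr).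

Lemma edot_suml (n : nat) (F : nat -> 'rV[R]_d) v :
  edot (\sum_(i < n) F i) v = \sum_(i < n) edot (F i) v.
Proof.
by elim: n => [|n IH]; rewrite ?big_ord0 ?edot0l// !big_ord_recr /= edotDl IH.
Qed.

Lemma edot_ge0 u : 0 <= edot u u.
Proof. by apply: sumr_ge0 => i _; rewrite -expr2 sqr_ge0. Qed.

Lemma enorm_ge0 u : 0 <= enorm u. Proof. exact: sqrtr_ge0. Qed.

Lemma sqr_enorm u : enorm u ^+ 2 = edot u u.
Proof. by rewrite sqr_sqrtr ?edot_ge0. Qed.

Lemma edot_eq0 u : edot u u = 0 -> u = 0.
Proof.
move=> h; apply/rowP => i; rewrite mxE.
have /eqP := psumr_eq0P (fun i _ => sqr_ge0 (u 0 i)) h (i := i) isT.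
by rewrite sqrf_eq0 => /eqP.
Qed.

Lemma enorm0 : enorm (0 : 'rV[R]_d) = 0.
Proof. by rewrite /enorm edot0l sqrtr0. Qed.

Lemma enorm_eq0 u : enorm u = 0 -> u = 0.
Proof. by move=> h; apply: edot_eq0; rewrite -sqr_enorm h expr0n. Qed.

Lemma enorm_gt0 u : u != 0 -> 0 < enorm u.
Proof.
by move=> h; rewrite lt_def enorm_ge0 andbT; apply: contra_neq h => /enorm_eq0.
Qed.

Lemma enormN u : enorm (- u) = enorm u.
Proof. by rewrite /enorm !edotE opprK. Qed.

Lemma enormB u v : enorm (u - v) = enorm (v - u).
Proof. by rewrite -enormN opprB. Qed.

Lemma enormZ k u : enorm (k *: u) = `|k| * enorm u.
Proof. by rewrite /enorm !edotE mulrA -expr2 sqrtrM ?sqr_ge0// sqrtr_sqr. Qed.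

Lemma sqr_le_enorm u k : 0 <= k -> edot u u <= k ^+ 2 -> enorm u <= k.
Proof. by move=> k0; rewrite -sqr_enorm ler_sqr ?nnegrE ?enorm_ge0. Qed.

Lemma enorm_le_sqr u k : enorm u <= k -> edot u u <= k ^+ 2.
Proof.
move=> h; rewrite -sqr_enorm ler_sqr ?nnegrE ?enorm_ge0//.
exact: le_trans (enorm_ge0 u) h.
Qed.

Lemma edot_le u v : edot u v <= enorm u * enorm v.
Proof.
have [->|u0] := eqVneq u 0; first by rewrite edot0l enorm0 mul0r.
have [->|v0] := eqVneq v 0; first by rewrite edot0r enorm0 mulr0.
have := edot_ge0 (enorm v *: u - enorm u *: v).
rewrite !edotE -!sqr_enorm (edotC v u) => h.
have p : 0 < enorm u * enorm v by rewrite mulr_gt0 ?enorm_gt0.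
have : (enorm u * enorm v) * edot u v <= (enorm u * enorm v) * (enorm u * enorm v).
  by move: h; lra.
by rewrite ler_pM2l.
Qed.

Lemma edot_abs_le u v : `|edot u v| <= enorm u * enorm v.
Proof.
by rewrite ler_norml edot_le andbT lerNl -edotNl -[enorm u]enormN edot_le.
Qed.

Lemma enormD u v : enorm (u + v) <= enorm u + enorm v.
Proof.
apply: sqr_le_enorm; first by rewrite addr_ge0 ?enorm_ge0.
by rewrite !edotE -!sqr_enorm (edotC v u); have := edot_le u v; nra.
Qed.

Lemma enorm_triangle x y z : enorm (x - z) <= enorm (x - y) + enorm (y - z).
Proof. by rewrite -[x in enorm x](_ : (x - y) + (y - z) = x - z) ?enormD// addrA subrK. Qed.

Lemma enorm_sum (n : nat) (F : nat -> 'rV[R]_d) :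
  enorm (\sum_(i < n) F i) <= \sum_(i < n) enorm (F i).
Proof.
elim: n => [|n IH]; first by rewrite !big_ord0 enorm0.
by rewrite !big_ord_recr /=; apply: le_trans (enormD _ _) _; rewrite lerD2r.
Qed.

Lemma norm_le_enorm u : `|u| <= enorm u.
Proof.
rewrite /Num.norm /= mx_normrE; apply/bigmax_leP; split; first exact: enorm_ge0.
move=> [i j] _ /=; rewrite (ord1 i) -sqrtr_sqr ler_wsqrtr//.
rewrite /edot (bigD1 j)//= -expr2 lerDl sumr_ge0// => l _.
by rewrite -expr2 sqr_ge0.
Qed.

(** * Limits along filters, and compactness along ultrafilters *)

Section Limits.
Context {T : Type} {F : set_system T} {FF : ProperFilter F}.
Implicit Types f g : T -> 'rV[R]_d.

Lemma cvg_sumr (I : Type) (s : seq I) (f : I -> T -> R) (l : I -> R) :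
  (forall i, f i @ F --> l i) ->
  (fun t => \sum_(i <- s) f i t) @ F --> \sum_(i <- s) l i.
Proof.
move=> fl; elim: s => [|i s IH].
  rewrite big_nil (_ : (fun t => _) = cst 0); first exact: cvg_cst.
  by apply/funext => t; rewrite big_nil.
rewrite big_cons (_ : (fun t => _) = f i \+ fun t => \sum_(j <- s) f j t).
  exact: cvgD.
by apply/funext => t; rewrite big_cons.
Qed.

Lemma cvg_edot f g x y :
  f @ F --> x -> g @ F --> y -> (fun t => edot (f t) (g t)) @ F --> edot x y.
Proof.
move=> fx gy; rewrite /edot.
have cc (h : T -> 'rV[R]_d) z i : h @ F --> z -> (fun t => h t 0 i) @ F --> z 0 i.
  move=> hz; apply: (cvg_comp h (fun M : 'rV[R]_d => M 0 i) hz).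
  exact: coord_continuous.
apply: (@cvg_sumr 'I_d _ (fun i t => f t 0 i * g t 0 i)) => i.
by apply: cvgM; apply: cc.
Qed.

Lemma cvg_enorm f x : f @ F --> x -> (fun t => enorm (f t)) @ F --> enorm x.
Proof.
move=> fx; apply: (cvg_comp (fun t => edot (f t) (f t)) Num.sqrt (cvg_edot fx fx)).
exact: sqrt_continuous.
Qed.

Lemma enorm_cvg f x (g : T -> R) : g @ F --> 0 ->
  (\forall t \near F, enorm (x - f t) <= g t) -> f @ F --> x.
Proof.
move=> g0 fg; apply/cvgrPdist_le => e e0.
move/cvgrPdist_le : g0 => /(_ _ e0); apply: filterS2 fg => t fg.
rewrite sub0r normrN; apply: le_trans; apply: le_trans (norm_le_enorm _) _.
exact: le_trans fg (ler_norm _).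
Qed.

End Limits.

(** Closed balls are compact, so the image ultrafilter has a cluster point, and a cluster point of
    an ultrafilter is a limit. One fixed ultrafilter thus makes any number of bounded sequences
    converge at once, without extracting subsequences. *)
Lemma ultra_bounded_cvg (T : Type) (U : set_system T) {UU : UltraFilter U}
    (f : T -> 'rV[R]_d) (M : R) :
  (forall t, enorm (f t) <= M) -> exists x, f @ U --> x.
Proof.
move=> fM; pose K := [set x : 'rV[R]_d | `|x| <= M].
have Kc : compact K.
  apply: bounded_closed_compact.
    exists M; split; first exact: num_real.
    by move=> t Mt x /= xM; apply: le_trans xM (ltW Mt).
  apply: (@closed_comp _ _ (fun x : 'rV[R]_d => `|x|) [set y | y <= M]).
    by move=> x _; exact: norm_continuous.
  exact: closed_le.
have Kf t : K (f t) by apply: le_trans (norm_le_enorm _) (fM t).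
have KU : (f @ U) K by apply: (@filterE _ U _ (fun t => K (f t))).
have [x [_ clx]] := Kc (f @ U) _ KU.
exists x => B Bx.
have [//|Bf] := in_ultra_setVsetC (f @^-1` B) UU.
by have [y []] := clx (~` B) B Bf Bx.
Qed.

(** The direct method: the coordinates of a minimising sequence converge along a common ultrafilter.
    The index type is [bool] for a point paired with its nearest point, and [nat] for chains. *)
Lemma attains_min (I : Type) (S : set (I -> 'rV[R]_d)) (f : (I -> 'rV[R]_d) -> R)
    (m : R) (B : I -> R) :
  S !=set0 -> (forall p, S p -> m <= f p) ->
  (forall p i, S p -> enorm (p i) <= B i) ->
  (forall (U : set_system nat) (P : nat -> I -> 'rV[R]_d) p, UltraFilter U ->
     (forall n, S (P n)) -> (forall i, (fun n => P n i) @ U --> p i) ->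
     S p /\ (fun n => f (P n)) @ U --> f p) ->
  exists p, S p /\ forall q, S q -> f p <= f q.
Proof.
move=> [p0 Sp0] fm SB Scl.
pose E := f @` S.
have hE : has_inf E.
  by split; [exists (f p0); exists p0 | exists m => _ [p Sp <-]; exact: fm].
have h (n : nat) : exists p, S p /\ f p <= inf E + harmonic n.
  have [_ [p Sp <-] /ltW fp] := inf_adherent (harmonic_gt0 n : 0 < harmonic n :> R) hE.
  by exists p.
have [P hP] := choice h.
have [U [UU sU]] := ultraFilterLemma (eventually_filter).
have /choice[p hp] : forall i, exists x, (fun n => P n i) @ U --> x.
  by move=> i; apply: (@ultra_bounded_cvg _ U UU _ (B i)) => n; apply: SB; case: (hP n).
have [Sp fp] := Scl U P p UU (fun n => (hP n).1) hp.
exists p; split=> // q Sq.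
apply: (@le_trans _ _ (inf E)); last by apply: ge_inf; [case: hE | exists q].
apply: (ler_cvg_to fp (g := fun n => inf E + harmonic n)); last first.
  by apply: filterE => n; case: (hP n).
rewrite -[X in _ --> X]addr0; apply: cvgD; first exact: cvg_cst.
by apply: cvg_trans (@cvg_harmonic R) => A /sU.
Qed.

End Euclid.

(** * Balls touching a set of positive reach *)

(** The body of [positive_reach] at a fixed radius, since later constants depend on a radius below
    [eps]. *)
Definition unique_nearest (R : realType) (d : nat) (A : set 'rV[R]_d) (eps : R) :=
  forall x : 'rV[R]_d, (exists y, A y /\ enorm (x - y) < eps) ->
    exists p, nearest A x p /\ forall p', nearest A x p' -> p' = p.

Section Reach.
Variables (R : realType) (d : nat) (A : set 'rV[R]_d) (eps : R).
Hypothesis eps_gt0 : 0 < eps.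
Hypothesis hA : unique_nearest A eps.
Implicit Types (p q x y : 'rV[R]_d).

(** A limit of points of [A] is at distance less than [eps] from [A], so it has a nearest point; the
    distance to it is at most [enorm (x - f t)] for every [t], hence zero. *)
Lemma reach_closed (T : Type) (F : set_system T) {FF : ProperFilter F}
    (f : T -> 'rV[R]_d) x : f @ F --> x -> (forall t, A (f t)) -> A x.
Proof.
move=> fx Af.
have h : (fun t => enorm (x - f t)) @ F --> 0.
  by rewrite -(enorm0 R d) -(subrr x); apply: cvg_enorm; apply: cvgB => //; exact: cvg_cst.
have [t ht] : exists t, enorm (x - f t) < eps.
  have /cvgrPdist_lt/(_ _ eps_gt0) := h => /filter_ex[t].
  by rewrite sub0r normrN ger0_norm ?enorm_ge0// => ht; exists t.
have [p [[Ap xp] _]] := hA (ex_intro _ (f t) (conj (Af t) ht)).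
suff : enorm (x - p) <= 0.
  move=> le0; suff /eqP : x - p = 0 by rewrite subr_eq0 => /eqP ->.
  by apply: enorm_eq0; apply/eqP; rewrite eq_le le0 enorm_ge0.
by apply: (cvgr_to_ge h); apply: filterE => t'; exact: xp.
Qed.

Lemma nearest_ex x y : A y -> enorm (x - y) < eps -> exists p, nearest A x p.
Proof.
by move=> Ay xy; have [|p [h _]] := hA (x := x); [exists y | exists p].
Qed.

(* Uniqueness of the nearest point makes the distance to [A] grow with slope 1
   when moving straight away from that point. *)
Lemma dist_slope y q (lam e : R) : nearest A y q -> 0 < enorm (y - q) < eps ->
  0 <= lam < 1 -> 0 < e ->
  exists eta : R, 0 < eta <= e /\ forall q', A q' ->
    (1 + lam * eta) * enorm (y - q) < enorm (y + eta *: (y - q) - q').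
Proof.
move=> [Aq nq] /andP[D0 Deps] /andP[lam0 lam1] e0.
set D := enorm (y - q) in nq D0 Deps *.
(* If no [eta] works, then for each [eta n] decreasing to 0 some [qs n] in [A] violates the
   bound. *)
apply: contrapT => no.
pose eta n : R := e * harmonic n.
have eta0 n : 0 < eta n by rewrite mulr_gt0 ?harmonic_gt0.
have etae n : eta n <= e.
  rewrite -[leRHS]mulr1 ler_pM2l// /harmonic invf_le1 ?ltr0Sn//.
  by rewrite ler1n.
have /choice[qs hq] : forall n, exists q', A q' /\
    enorm (y + eta n *: (y - q) - q') <= (1 + lam * eta n) * D.
  move=> n; apply: contrapT => h; apply: no; exists (eta n); split.
    by rewrite eta0 etae.
  by move=> q' Aq'; rewrite ltNge; apply/negP => h'; apply: h; exists q'.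
have [U [UU sU]] := ultraFilterLemma (eventually_filter).
have [n|qoo qoo_lim] := @ultra_bounded_cvg _ _ _ U UU qs
    (enorm y + e * D + (1 + lam * e) * D).
  have [_ h] := hq n.
  rewrite -[qs n](_ : (y + eta n *: (y - q)) - (y + eta n *: (y - q) - qs n) = _); last first.
    by rewrite opprB addrC subrK.
  apply: le_trans (enormD _ _) _; rewrite enormN; apply: lerD.
    apply: le_trans (enormD _ _) _; rewrite enormZ (gtr0_norm (eta0 n)) lerD2l.
    by rewrite ler_pM2r.
  apply: le_trans h _; rewrite ler_pM2r// lerD2l; exact: ler_wpM2l.
have eta_lim : eta @ U --> 0.
  rewrite -[X in _ --> X](mulr0 e); apply: cvgM; first exact: cvg_cst.
  by apply: cvg_trans (@cvg_harmonic R) => B /sU.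
have Aqoo : A qoo by apply: (reach_closed qoo_lim) => n; case: (hq n).
(* The limit [qoo] of the violating points is also nearest to [y]; uniqueness identifies it with
   [q]. *)
have qooE : qoo = q.
  have [p [_ up]] := hA (ex_intro _ q (conj Aq Deps)).
  rewrite (up q) // (up qoo) //; split=> // q' Aq'; apply: le_trans (nq q' Aq').
  apply: (ler_cvg_to (f := fun n => enorm (y + eta n *: (y - q) - qs n))
     (g := fun n => (1 + lam * eta n) * D) (a := U)).
  - apply: cvg_enorm; apply: cvgB => //.
    rewrite -[X in _ --> X]addr0; apply: cvgD; first exact: cvg_cst.
    rewrite -(scale0r (y - q)); apply: cvgZ => //; exact: cvg_cst.
  - rewrite -[X in _ --> X]mul1r; apply: cvgM; last exact: cvg_cst.
    rewrite -[X in _ --> X]addr0; apply: cvgD; first exact: cvg_cst.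
    rewrite -(mulr0 lam); apply: cvgM => //; exact: cvg_cst.
  - by apply: filterE => n; case: (hq n).
(* Squaring the violated bound and using [D <= enorm (y - qs n)] leaves
   [<y - q, y - qs n> <= lam D^2] after division by [2 eta n]. In the limit this reads
   [D^2 <= lam D^2], against [lam < 1]. *)
have : edot (y - q) (y - q) <= lam * D ^+ 2.
  rewrite -{2}qooE; apply: (cvgr_to_le (f := fun n => edot (y - q) (y - qs n)) (F := U)).
    by apply: cvg_edot; [|apply: cvgB => //]; exact: cvg_cst.
  apply: filterE => n; have [Aqn /enorm_le_sqr] := hq n.
  have -> : y + eta n *: (y - q) - qs n = (y - qs n) + eta n *: (y - q) by rewrite addrAC.
  move: (y - qs n) (nq _ Aqn) => z Dz.
  have hz : D ^+ 2 <= edot z z by rewrite -sqr_enorm ler_sqr ?nnegrE ?enorm_ge0// ltW.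
  have hD : edot (y - q) (y - q) = D ^+ 2 by rewrite -sqr_enorm.
  move: (y - q) hD => v hD; rewrite !edotE hD (edotC z v) => h.
  rewrite -(ler_pM2l (eta0 n)).
  have l2 : lam ^+ 2 <= 1 by rewrite expr_le1// ltW.
  have k0 : 0 <= (eta n * D) ^+ 2 by exact: sqr_ge0.
  have : lam ^+ 2 * (eta n * D) ^+ 2 <= (eta n * D) ^+ 2 by rewrite ler_piMl.
  by move: h hz; nra.
rewrite -sqr_enorm -/D -[X in X <= _]mul1r ler_pM2r ?exprn_gt0//.
by rewrite leNgt lam1.
Qed.

(** Minimise [lam |y - x| - dist(y, A)] over the ball of radius [s - enorm (x - p)] around [x].
    Comparison with [y = x] bounds [dist(y, A)] from below, and the minimiser lies on the sphere
    because [dist_slope] improves any interior point. *)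
Lemma ball_grow_approx x p (s lam : R) : nearest A x p -> 0 < enorm (x - p) <= s ->
  s < eps -> 0 <= lam < 1 ->
  exists y, enorm (y - x) <= s - enorm (x - p) /\
    forall q, A q -> enorm (x - p) + lam * (s - enorm (x - p)) <= enorm (y - q).
Proof.
move=> nxp; set t := enorm (x - p) => /andP[t0 ts] seps hlam.
have [Ap xp] := nxp; have /andP[lam0 lam1] := hlam.
(* A pair is encoded as a function on [bool]: [P true] is the moving point and [P false] a point of
   [A] nearest to it, so that the distance to [A] becomes a continuous function of the pair. *)
pose S := [set P : bool -> 'rV[R]_d |
  enorm (P true - x) <= s - t /\ nearest A (P true) (P false)].
have near_p y : enorm (y - x) <= s - t -> enorm (y - p) <= s.
  by move=> h; apply: le_trans (enorm_triangle y x p) _; rewrite -/t; lra.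
have [||P i||P [[Px PN] Pmin]] := @attains_min R d bool S
  (fun P => lam * enorm (P true - x) - enorm (P true - P false)) (- s)
  (fun=> enorm x + s + s).
- exists (fun b => if b then x else p); split=> //.
  by rewrite /= subrr enorm0 subr_ge0.
- move=> P [Px [_ PN]].
  have := mulr_ge0 lam0 (enorm_ge0 (P true - x)).
  by have := PN p Ap; have := near_p _ Px; lra.
- move=> [Px [_ PN]].
  have h1 : enorm (P true) <= enorm x + s.
    rewrite -[P true](subrK x); apply: le_trans (enormD _ _) _.
    by have := t0; lra.
  case: i; first by have := le_trans (ltW t0) ts; lra.
  rewrite -[P false](_ : P true - (P true - P false) = _); last first.
    by rewrite opprB addrC subrK.
  apply: le_trans (enormD _ _) _; rewrite enormN.
  by have := PN p Ap; have := near_p _ Px; lra.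
- move=> U P p0 UU SP Pp0.
  have c1 : (fun n => enorm (P n true - x)) @ U --> enorm (p0 true - x).
    by apply: cvg_enorm; apply: cvgB => //; exact: cvg_cst.
  have c2 : (fun n => enorm (P n true - P n false)) @ U --> enorm (p0 true - p0 false).
    by apply: cvg_enorm; apply: cvgB.
  split; last by apply: cvgB => //; apply: cvgM => //; exact: cvg_cst.
  split; first by apply: (cvgr_to_le c1); apply: filterE => n; case: (SP n).
  split.
    by apply: (reach_closed (Pp0 false)) => n; case: (SP n) => _ [].
  move=> q Aq.
  apply: (ler_cvg_to c2 (g := fun n => enorm (P n true - q))).
    by apply: cvg_enorm; apply: cvgB => //; exact: cvg_cst.
  by apply: filterE => n; case: (SP n) => _ [_]; apply.
move: (P true) (P false) Px PN Pmin => y q yx yq Pmin {P}.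
have Dy : t + lam * enorm (y - x) <= enorm (y - q).
  have := Pmin (fun b => if b then x else p).
  rewrite /= subrr enorm0 mulr0 sub0r -/t => h.
  have : S (fun b => if b then x else p).
    by split=> //; rewrite /= subrr enorm0 subr_ge0.
  by move=> /h; lra.
exists y; split=> // q' Aq'.
have [yxE|yxN] := eqVneq (enorm (y - x)) (s - t).
  by rewrite -yxE; apply: le_trans Dy _; exact: yq.2.
exfalso.
have yxlt : enorm (y - x) < s - t by rewrite lt_neqAle yxN.
have D0 : 0 < enorm (y - q).
  by apply: lt_le_trans Dy; rewrite ltr_wpDr// mulr_ge0// enorm_ge0.
have Ds : enorm (y - q) <= s by apply: le_trans (near_p _ yx); exact: yq.2.
(* The bound on [eta] keeps [y'] inside the ball. Moving from [y] to [y'] raises the penalty by at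
   most [lam * eta * enorm (y - q)], and the distance to [A] by strictly more. *)
have [||eta [/andP[eta0 etae] far]] :=
  @dist_slope y q lam ((s - t - enorm (y - x)) / enorm (y - q)) yq _ hlam _.
- by rewrite D0 (le_lt_trans Ds).
- by rewrite divr_gt0// subr_gt0.
set y' := y + eta *: (y - q) in far.
have y'y : enorm (y' - y) = eta * enorm (y - q).
  by rewrite /y' addrAC subrr add0r enormZ gtr0_norm.
have etaD : eta * enorm (y - q) <= s - t - enorm (y - x) by rewrite -ler_pdivlMr.
have y'x : enorm (y' - x) <= enorm (y - x) + eta * enorm (y - q).
  by apply: le_trans (enorm_triangle y' y x) _; rewrite y'y addrC.
have y's : enorm (y' - x) <= s - t by lra.
have [q0 nq0] := nearest_ex Ap (le_lt_trans (near_p _ y's) seps).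
have := Pmin (fun b => if b then y' else q0) (conj y's nq0).
have := far q0 nq0.1.
have : lam * enorm (y' - x) <= lam * (enorm (y - x) + eta * enorm (y - q)).
  exact: ler_wpM2l.
by rewrite /=; nra.
Qed.

(** Letting [lam] tend to 1 in [ball_grow_approx] gives a centre [y] of a ball of radius [s] with no
    point of [A] in its interior and [p] on its boundary. Expanding [s^2 <= |y - q|^2] around [p]
    gives the claim. *)
Lemma nearest_ineq x p q (s : R) : nearest A x p -> enorm (x - p) <= s -> s < eps ->
  A q -> 2 * s * edot (x - p) (q - p) <= enorm (x - p) * edot (q - p) (q - p).
Proof.
move=> nxp ts seps Aq.
have [/enorm_eq0 ->|tn] := eqVneq (enorm (x - p)) 0.
  by rewrite edot0l enorm0 mulr0 mul0r.
have t0 : 0 < enorm (x - p) by rewrite lt_def tn enorm_ge0.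
set t := enorm (x - p) in ts tn t0 *.
have [Ap xp] := nxp.
have /choice[ys hys] : forall n : nat, exists y, enorm (y - x) <= s - t /\
    forall q, A q -> t + (1 - harmonic n) * (s - t) <= enorm (y - q).
  move=> n; apply: ball_grow_approx => //; first by rewrite t0.
  rewrite subr_ge0 ltrBlDr ltrDl harmonic_gt0 andbT.
  by rewrite /harmonic invf_le1 ?ltr0Sn// ler1n.
have [U [UU sU]] := ultraFilterLemma (eventually_filter).
have [n|y y_lim] := @ultra_bounded_cvg _ _ _ U UU ys (enorm x + (s - t)).
  rewrite -[ys n](subrK x) addrC; apply: le_trans (enormD _ _) _.
  by rewrite lerD2l; case: (hys n).
have yx : enorm (y - x) <= s - t.
  apply: (cvgr_to_le (f := fun n => enorm (ys n - x)) (F := U)).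
    by apply: cvg_enorm; apply: cvgB => //; exact: cvg_cst.
  by apply: filterE => n; case: (hys n).
have far q' : A q' -> s <= enorm (y - q').
  move=> Aq'.
  apply: (ler_cvg_to (f := fun n => t + (1 - harmonic n) * (s - t))
     (g := fun n => enorm (ys n - q')) (a := U)).
  - rewrite -[X in _ --> X](_ : t + (1 - 0) * (s - t) = s); last by ring.
    apply: cvgD; first exact: cvg_cst.
    apply: cvgM; last exact: cvg_cst.
    apply: cvgB; first exact: cvg_cst.
    by apply: cvg_trans (@cvg_harmonic R) => B /sU.
  - by apply: cvg_enorm; apply: cvgB => //; exact: cvg_cst.
  - by apply: filterE => n; case: (hys n) => _; apply.
have s0 : 0 < s by exact: lt_le_trans ts.
have sq_far q' : A q' -> s ^+ 2 <= edot (y - q') (y - q').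
  by move=> /far h; rewrite -sqr_enorm ler_sqr ?nnegrE ?enorm_ge0// ltW.
have xpE : edot (x - p) (x - p) = t ^+ 2 by rewrite -sqr_enorm.
(* Equality case of the triangle inequality: [|y - x| <= s - t], [|x - p| = t] and [|y - p| >= s]
   put [y] on the ray from [p] through [x]. *)
have yE : t *: (y - p) = s *: (x - p).
  have := sq_far p Ap; have := enorm_le_sqr yx.
  have -> : y - p = (y - x) + (x - p) by rewrite addrA subrK.
  move: (y - x) (x - p) xpE => z v hv hz.
  rewrite !edotE hv (edotC v z) => h.
  suff /edot_eq0 : edot (t *: z - (s - t) *: v) (t *: z - (s - t) *: v) = 0.
    move/eqP; rewrite subr_eq0 => /eqP E.
    by rewrite scalerDr E -scalerDl subrK.
  apply/eqP; rewrite eq_le edot_ge0 andbT !edotE hv (edotC v z).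
  have h1 : t * (s - t) <= edot z v by move: h hz; nra.
  have h2 : 0 <= t * (s - t) by rewrite mulr_ge0 ?subr_ge0// ltW.
  have h3 : t * (s - t) * (t * (s - t)) <= t * (s - t) * edot z v by exact: ler_wpM2l.
  have h4 : t ^+ 2 * edot z z <= t ^+ 2 * (s - t) ^+ 2 by rewrite ler_wpM2l// sqr_ge0.
  by move: h3 h4; nra.
have ypE : edot (y - p) (y - p) = s ^+ 2.
  have : edot (t *: (y - p)) (t *: (y - p)) = t ^+ 2 * s ^+ 2.
    by rewrite yE edotZl edotZr xpE; ring.
  rewrite edotZl edotZr => h; have t2 : t ^+ 2 != 0 by rewrite expf_neq0// gt_eqF.
  by apply: (mulfI t2); rewrite -h; ring.
have := sq_far q Aq; have -> : y - q = (y - p) - (q - p) by rewrite opprB addrA subrK.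
have E2 : t * edot (y - p) (q - p) = s * edot (x - p) (q - p) by rewrite -!edotZl yE.
move: (q - p) (x - p) (y - p) E2 ypE => z v u E2 uE.
rewrite !edotE uE (edotC z u) => h.
have : 2 * edot u z <= edot z z by move: h; lra.
rewrite -(ler_pM2l t0) => h2.
by rewrite -mulrA -E2; move: h2; lra.
Qed.

(* Adding [nearest_ineq] at the two ends of the segment. *)
Lemma midpoint_nearest b c p (r : R) : 0 < r < eps -> A b -> A c ->
  nearest A (2^-1 *: (b + c)) p -> enorm (c - b) <= 2 * r ->
  4 * r * enorm (2^-1 *: (b + c) - p) <= edot (c - b) (c - b).
Proof.
move=> /andP[r0 reps] Ab Ac np hl.
set m := 2^-1 *: (b + c) in np *.
set h := enorm (m - p).
have mb : m - b = 2^-1 *: (c - b).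
  by apply/rowP => i; rewrite !mxE; lra.
have hr : h <= enorm (c - b) / 2.
  by apply: le_trans (np.2 b Ab) _; rewrite mb enormZ ger0_norm ?invr_ge0// mulrC.
have hr' : h <= r by lra.
have h0 : 0 <= h by exact: enorm_ge0.
have h1 := nearest_ineq np hr' reps Ab.
have h2 := nearest_ineq np hr' reps Ac.
have bE : b - p = (m - p) - 2^-1 *: (c - b).
  by apply/rowP => i; rewrite !mxE; lra.
have cE : c - p = (m - p) + 2^-1 *: (c - b).
  by apply/rowP => i; rewrite !mxE; lra.
move: h1 h2; rewrite bE cE -/h.
have : edot (m - p) (m - p) = h ^+ 2 by rewrite -sqr_enorm.
move: (m - p) (c - b) => u v uE.
rewrite !edotE uE (edotC v u) => h1 h2.
have [h00|hn] := eqVneq h 0; first by rewrite h00 mulr0 edot_ge0.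
have hp : 0 < h by rewrite lt_def hn.
rewrite -(ler_pM2l hp).
(* The two inequalities add up to [4 r h^2 <= 2 h^3 + h |c - b|^2 / 2]; the cubic term is absorbed
   by [h <= r]. *)
have : h ^+ 2 * h <= h ^+ 2 * r by rewrite ler_wpM2l// sqr_ge0.
by move: h1 h2; nra.
Qed.

End Reach.

(** * Tangent lines *)

Section Tangent.
Variables (R : realType) (d : nat).
Implicit Types (A : set 'rV[R]_d) (b p q u v w x y z : 'rV[R]_d).

Definition perp w v := v - edot v w *: w.

Lemma edot_perp n w v : edot n w = 0 -> edot n (perp w v) = edot n v.
Proof. by move=> nw; rewrite /perp edotDr edotNr edotZr nw mulr0 subr0. Qed.

Lemma edot_perpr w v : enorm w = 1 -> edot (perp w v) w = 0.
Proof. by move=> w1; rewrite /perp !edotE -sqr_enorm w1; ring. Qed.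

Lemma perpZ w k v : perp w (k *: v) = k *: perp w v.
Proof. by rewrite /perp edotZl scalerBr scalerA. Qed.

Lemma unit_line w : w != 0 -> exists w', enorm w' = 1 /\ line w = line w'.
Proof.
move=> w0; have n0 := enorm_gt0 w0.
exists ((enorm w)^-1 *: w); split.
  by rewrite enormZ gtr0_norm ?invr_gt0// mulVf// gt_eqF.
apply/seteqP; split => _ [t _ <-].
  by exists (t * enorm w) => //; rewrite scalerA mulfK// gt_eqF.
by exists (t * (enorm w)^-1) => //; rewrite scalerA.
Qed.

Lemma sub_span (S : set 'rV[R]_d) : S `<=` Defs.span S.
Proof.
move=> v Sv; exists 1%N, (fun=> 1), (fun=> v); split=> //.
by rewrite big_ord1 scale1r.
Qed.

Lemma T1_line A b : T1 A b -> exists w, enorm w = 1 /\ Tan A b `<=` line w.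
Proof.
move=> [_ [w [/unit_line[w' [w1 wE]] sE]]]; exists w'; split=> //.
by rewrite -wE -sE; exact: sub_span.
Qed.

Lemma T1plus_line A b : T1plus A b -> exists w, enorm w = 1 /\ Tan A b = line w.
Proof.
move=> [[_ [w [/unit_line[w' [w1 wE]] sE]]] ->]; exists w'; split=> //.
by rewrite -wE -sE.
Qed.

(** The last inequality is homogeneous in [q - b], so it can be tested on the rescaled differences,
    which tend to the unit vector [u]: the cosine tends to 1, which exceeds 3/4. *)
Lemma Tan_direction A b u (e : R) : Tan A b u -> enorm u = 1 -> 0 < e ->
  exists q, [/\ A q, q != b, enorm (q - b) < e & 3 / 4 * enorm (q - b) <= edot (q - b) u].
Proof.
move=> [->|]; first by rewrite enorm0 => /eqP; rewrite eq_sym oner_eq0.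
move=> [xs [r [h [xb ru]]]] u1 e0.
have c1 : (fun i => enorm (xs i - b)) @ \oo --> 0.
  by rewrite -(enorm0 R d) -(subrr b); apply: cvg_enorm; apply: cvgB => //; exact: cvg_cst.
have c2 : (fun i => edot (r i *: (xs i - b)) u - 3 / 4 * enorm (r i *: (xs i - b))) @ \oo -->
    (1 - 3 / 4 * 1 : R).
  apply: cvgB; first by rewrite -(expr1n _ 2) -u1 sqr_enorm; apply: cvg_edot => //; exact: cvg_cst.
  by rewrite -u1; apply: cvgM; [exact: cvg_cst | exact: cvg_enorm].
have q0 : (0 : R) < 1 - 3 / 4 * 1 by lra.
have n1 : \forall i \near \oo, enorm (xs i - b) < e by apply: (cvgr_lt _ c1).
have n2 : \forall i \near \oo,
    0 < edot (r i *: (xs i - b)) u - 3 / 4 * enorm (r i *: (xs i - b)).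
  by apply: (cvgr_gt _ c2).
have [i [/= i1 i2]] := filter_ex (filterI n1 n2).
have [Ai [xi ri]] := h i.
exists (xs i); split=> //.
rewrite -(ler_pM2l ri) -edotZl mulrCA -{1}(gtr0_norm ri) -enormZ -subr_ge0.
exact: ltW.
Qed.

(** Otherwise points of [A] tend to [b] in unit directions whose component orthogonal to [w] exceeds
    [eta]; a limit direction is tangent but not on the line. *)
Lemma tangent_cone A b w (eta : R) : Tan A b `<=` line w -> enorm w = 1 -> 0 < eta ->
  exists rho : R, 0 < rho /\ forall q, A q -> enorm (q - b) < rho ->
    enorm (perp w (q - b)) <= eta * enorm (q - b).
Proof.
move=> Tw w1 eta0; apply: contrapT => no.
have /choice[q hq] : forall n : nat, exists q, [/\ A q, enorm (q - b) < harmonic n &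
    eta * enorm (q - b) < enorm (perp w (q - b))].
  move=> n; apply: contrapT => h; apply: no; exists (harmonic n).
  rewrite harmonic_gt0; split=> // q Aq qb; rewrite leNgt; apply/negP => h'.
  by apply: h; exists q.
have qb n : q n != b.
  apply/eqP => E; have [_ _] := hq n.
  by rewrite E subrr /perp edot0l scale0r subrr enorm0 mulr0 ltxx.
have nq n : 0 < enorm (q n - b) by rewrite enorm_gt0// subr_eq0.
pose u n := (enorm (q n - b))^-1 *: (q n - b).
have u1 n : enorm (u n) = 1.
  by rewrite enormZ gtr0_norm ?invr_gt0// mulVf// gt_eqF.
have [U [UU sU]] := ultraFilterLemma (eventually_filter).
have [n|u0 u_lim] := @ultra_bounded_cvg _ _ _ U UU u 1; first by rewrite u1.
have : Tan A b u0.
  right.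
  (* [Tan] asks for an ordinary sequence, so indices [k n >= n] with [u (k n)] close to [u0] are
     picked from the ultrafilter. *)
  have /choice[k hk] : forall n : nat, exists k, (n <= k)%N /\ enorm (u0 - u k) < harmonic n.
    move=> n.
    have c : (fun k => enorm (u0 - u k)) @ U --> 0.
      by rewrite -(enorm0 R d) -(subrr u0); apply: cvg_enorm; apply: cvgB => //; exact: cvg_cst.
    have n1 : \forall k \near U, enorm (u0 - u k) < harmonic n.
      by apply: (cvgr_lt _ c); exact: harmonic_gt0.
    have n2 : \forall k \near U, (n <= k)%N by apply: sU; exact: nbhs_infty_ge.
    by have [k [? ?]] := filter_ex (filterI n1 n2); exists k.
  exists (q \o k), (fun n => (enorm (q (k n) - b))^-1); split; last split.
  - by move=> i; have [? _ _] := hq (k i); rewrite invr_gt0; do !split => //=.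
  - apply: (enorm_cvg (@cvg_harmonic R)); apply: filterE => n; rewrite enormB ltW//=.
    have [_ h _] := hq (k n); apply: lt_le_trans h _.
    by rewrite /harmonic lef_pV2 ?posrE ?ltr0Sn// ler_nat ltnS; case: (hk n).
  - by apply: (enorm_cvg (@cvg_harmonic R)); apply: filterE => n; rewrite ltW//; case: (hk n).
move/Tw => [t _ tE].
suff : eta <= enorm (perp w u0).
  by rewrite -tE /perp edotZl -sqr_enorm w1 expr1n mulr1 subrr enorm0 leNgt eta0.
apply: (cvgr_to_ge (f := fun n => enorm (perp w (u n))) (F := U)).
  apply: cvg_enorm; apply: cvgB => //; apply: cvgZ; last exact: cvg_cst.
  by apply: cvg_edot => //; exact: cvg_cst.
apply: filterE => n; rewrite perpZ enormZ gtr0_norm ?invr_gt0//.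
by rewrite ler_pdivlMl// mulrC ltW//; case: (hq n).
Qed.

(** * Touching balls and parabolas at points with a tangent line *)

Section Reach.
Variables (A : set 'rV[R]_d) (eps r : R).
Hypothesis eps_gt0 : 0 < eps.
Hypothesis hA : unique_nearest A eps.
Hypothesis r_eps : 0 < r < eps.

(* The nearest points to [b + t n] are [o(t)]-close to [b], so [nearest_ineq]
   at those points passes to the limit. *)
Lemma normal_ineq b w n q : A b -> Tan A b `<=` line w -> enorm w = 1 ->
  enorm n = 1 -> edot n w = 0 -> A q ->
  2 * r * edot n (q - b) <= edot (q - b) (q - b).
Proof.
move=> Ab Tw w1 n1 nw Aq; have /andP[r0 reps] := r_eps.
set z := q - b; set D := enorm z.
have D0 : 0 <= D by exact: enorm_ge0.
(* The inequality is first shown with an error linear in the aperture [eta] of the cone, which can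
   then be made arbitrarily small. *)
suff key eta : 0 < eta <= 1 ->
    2 * r * edot n z <= D ^+ 2 + eta * (4 * r + 4 * r * D + 4 * D + 4).
  have C0 : 0 < 4 * r + 4 * r * D + 4 * D + 4.
    have := mulr_ge0 (ltW r0) D0; lra.
  rewrite -sqr_enorm -/z -/D; apply/ler_addgt0Pr => e e0.
  apply: le_trans (key (Num.min 1 (e / (4 * r + 4 * r * D + 4 * D + 4))) _) _.
    by rewrite lt_min ltr01 divr_gt0//= ge_min lexx.
  by rewrite lerD2l -ler_pdivlMr// ge_min lexx orbT.
move=> /andP[eta0 eta1].
have [rho [rho0 cone]] := tangent_cone Tw w1 eta0.
pose t := Num.min (rho / 3) (Num.min r 1).
have t0 : 0 < t by rewrite !lt_min divr_gt0// r0 ltr01.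
have trho : t <= rho / 3 by rewrite ge_min lexx.
have tr : t <= r by rewrite !ge_min lexx orbT.
have t1 : t <= 1 by rewrite !ge_min lexx !orbT.
have tn : enorm (t *: n) = t by rewrite enormZ n1 mulr1 gtr0_norm.
have xb : enorm (b + t *: n - b) = t by rewrite addrAC subrr add0r.
have [p np] : exists p, nearest A (b + t *: n) p.
  by apply: (nearest_ex hA Ab); rewrite xb (le_lt_trans tr).
have xp : enorm (b + t *: n - p) <= t by rewrite -{2}xb; exact: np.2.
have := nearest_ineq eps_gt0 hA np (le_trans xp tr) reps Aq.
have pE : b + t *: n - p = t *: n - (p - b) by rewrite opprB addrA [t *: n + _]addrC.
have qE : q - p = z - (p - b) by rewrite /z opprB addrA subrK.
rewrite qE; rewrite pE in xp *.
have : enorm (p - b) < rho -> enorm (perp w (p - b)) <= eta * enorm (p - b).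
  exact: cone np.1.
move: (p - b) xp => v xv conev.
have v2 : enorm v <= 2 * t.
  rewrite -[v](_ : t *: n - (t *: n - v) = v); last by rewrite opprB addrC subrK.
  by apply: le_trans (enormD _ _) _; rewrite enormN tn; lra.
have {}conev : enorm (perp w v) <= eta * enorm v by apply: conev; lra.
have v0 := enorm_ge0 v.
(* Squaring [|t n - v| <= t] gives [|v|^2 <= 2 t <n, v>], and since [n] is orthogonal to [w] the
   cone condition bounds [<n, v>] by [eta |v|]. *)
have veta : enorm v <= 2 * t * eta.
  have [->|vn] := eqVneq v 0; first by rewrite enorm0 !mulr_ge0// ltW.
  have vp := enorm_gt0 vn.
  rewrite -(ler_pM2l vp).
  have := enorm_le_sqr xv; rewrite !edotE -!sqr_enorm n1 (edotC v n).
  have : edot n v <= eta * enorm v.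
    rewrite -(edot_perp v nw); apply: le_trans (edot_le _ _) _.
    by rewrite n1 mul1r.
  rewrite -(ler_pM2l t0); nra.
clearbody z; move=> h.
have {}h : 2 * r * edot (t *: n - v) (z - v) <= t * edot (z - v) (z - v).
  by apply: le_trans h _; rewrite ler_wpM2r// edot_ge0.
move: h; rewrite !edotE -!sqr_enorm -/D (edotC z v).
have e1 : edot n v <= 2 * t * eta.
  by apply: le_trans (edot_le _ _) _; rewrite n1 mul1r.
have /ler_normlP[e2 e3] : `|edot v z| <= 2 * t * eta * D.
  by apply: le_trans (edot_abs_le _ _) _; rewrite ler_wpM2r.
have e4 : enorm v ^+ 2 <= 4 * t ^+ 2 * eta ^+ 2.
  have : enorm v ^+ 2 <= (2 * t * eta) ^+ 2 by rewrite ler_sqr ?nnegrE// !mulr_ge0// ltW.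
  by lra.
move: (edot n v) (edot v z) (edot n z) (enorm v ^+ 2) (sqr_ge0 (enorm v)) e1 e2 e3 e4
  => nv vz nz vv vv0 e1 e2 e3 e4 h.
rewrite -(ler_pM2l t0).
have te : 0 < t * eta by rewrite mulr_gt0.
have f1 : t * (t * eta) <= 1 * (t * eta) by rewrite ler_wpM2r// ltW.
have f2 : r * (t * nv) <= r * (t * (2 * t * eta)) by rewrite !ler_pM2l.
have f3 : r * vz <= r * (2 * t * eta * D) by rewrite ler_pM2l//; lra.
have f4 : t * (- vz) <= t * (2 * t * eta * D) by rewrite ler_pM2l.
have f5 : t * (t * eta) * D <= (t * eta) * D by rewrite ler_wpM2r// -[leRHS]mul1r.
have f6 : r * (t * (t * eta)) <= r * (t * eta) by rewrite ler_pM2l// -[leRHS]mul1r.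
have f7 : t * vv <= t * (4 * t ^+ 2 * eta ^+ 2) by rewrite ler_pM2l.
have f8 : t * (t ^+ 2 * eta ^+ 2) <= t * eta.
  have -> : t * (t ^+ 2 * eta ^+ 2) = (t * eta) * (t * (t * eta)) by ring.
  rewrite -[leRHS]mulr1 ler_pM2l// (le_trans f1)// mul1r.
  by rewrite mulr_ile1// ltW.
have f9 : 0 <= r * vv by rewrite mulr_ge0// ltW.
by move: h f2 f3 f4 f5 f6 f7 f8 f9; lra.
Qed.

(** This is [normal_ineq] for the normal [n] pointing along the orthogonal component of [q - b]. *)
Lemma parabola b w q : A b -> Tan A b `<=` line w -> enorm w = 1 -> A q ->
  2 * r * enorm (perp w (q - b)) <= edot (q - b) (q - b).
Proof.
move=> Ab Tw w1 Aq; set v := perp w (q - b).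
have [->|v0] := eqVneq v 0; first by rewrite enorm0 mulr0 edot_ge0.
have vn := enorm_gt0 v0.
have n1 : enorm ((enorm v)^-1 *: v) = 1.
  by rewrite enormZ gtr0_norm ?invr_gt0// mulVf// gt_eqF.
have nw : edot ((enorm v)^-1 *: v) w = 0 by rewrite edotZl edot_perpr// mulr0.
have <- : edot ((enorm v)^-1 *: v) (q - b) = enorm v.
  by rewrite -(edot_perp _ nw) -/v edotZl -sqr_enorm expr2 mulrA mulVf ?mul1r// gt_eqF.
exact: normal_ineq Ab Tw w1 n1 nw Aq.
Qed.

End Reach.
End Tangent.

(** * Chains of minimal energy *)

Section Chains.
Variables (R : realType) (d : nat).
Implicit Types (p : nat -> 'rV[R]_d) (b c q w : 'rV[R]_d).

Definition step p i := p i.+1 - p i.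

Definition energy N p := \sum_(i < N) edot (step p i) (step p i).

Lemma energy_ge0 N p : 0 <= energy N p.
Proof. by apply: sumr_ge0 => i _; exact: edot_ge0. Qed.

(** Isolates the two terms of the energy that change when the vertex [j.+1] is moved. *)
Lemma sum_consecutive (F : nat -> R) j N : (j.+1 < N)%N ->
  \sum_(i < N) F i =
  F j + F j.+1 + \sum_(i < N | (i != j :> nat) && (i != j.+1 :> nat)) F i.
Proof.
move=> jN; rewrite (bigD1 (Ordinal (ltnW jN)))//= (bigD1 (Ordinal jN))/=; last first.
  by rewrite -val_eqE /= eqn_leq ltnn.
by rewrite addrA; congr (_ + _); apply: eq_bigl => i.
Qed.

Lemma chain_sum p i n : p (i + n)%N - p i = \sum_(k < n) step p (i + k)%N.
Proof.
elim: n => [|n IH]; first by rewrite addn0 subrr big_ord0.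
by rewrite big_ord_recr /= -IH /step addnS addrC subrKA.
Qed.

Lemma chain_linear p i n (e : 'rV[R]_d) (M : R) :
  (forall k, (k < n)%N -> enorm (step p (i + k)%N - e) <= M) ->
  enorm (p (i + n)%N - p i - n%:R *: e) <= n%:R * M.
Proof.
move=> h; rewrite chain_sum.
have -> : n%:R *: e = \sum_(k < n) e by rewrite sumr_const card_ord scaler_nat.
rewrite -sumrB; apply: le_trans (enorm_sum n (fun k => step p (i + k) - e)) _.
rewrite mulr_natl -[X in _ *+ X](card_ord n) -sumr_const.
by apply: ler_sum => k _; exact: h.
Qed.

(** [T] is a majorant of the variation: partial sums of squared steps in one use, a linear function
    of the index in another. *)
Lemma telescope_le (e : nat -> 'rV[R]_d) (T : nat -> R) (N i j : nat) :
  (forall k, (k.+1 < N)%N -> enorm (e k.+1 - e k) <= T k.+1 - T k) ->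
  (i <= j)%N -> (j < N)%N -> enorm (e j - e i) <= T j - T i.
Proof.
move=> h; elim: j => [|j IH].
  by rewrite leqn0 => /eqP -> _; rewrite !subrr enorm0.
rewrite leq_eqVlt => /orP[/eqP -> _|]; first by rewrite !subrr enorm0.
rewrite ltnS => ij jN; apply: le_trans (enorm_triangle _ (e j) _) _.
by have := IH ij (ltnW jN); have := h j jN; lra.
Qed.

Lemma discrete_ivt (f : nat -> R) N (t : R) : (0 < N)%N -> f 0%N <= t <= f N ->
  exists i, (i < N)%N /\ f i <= t <= f i.+1.
Proof.
case: N => // N _; elim: N => [|N IH] h; first by exists 0%N.
have [tN|Nt] := leP t (f N.+1).
  have [|i [iN hi]] := IH; first by case/andP: h => ->.
  by exists i; split=> //; exact: ltnW.
by exists N.+1; split=> //; rewrite (ltW Nt); case/andP: h.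
Qed.

Section Reach.
Variables (A : set 'rV[R]_d) (eps r : R).
Hypothesis eps_gt0 : 0 < eps.
Hypothesis hA : unique_nearest A eps.
Hypothesis r_eps : 0 < r < eps.

(** A path of [N] edges is a sequence on all of [nat], frozen at [c] from index [N] on, so that
    pieces can be concatenated and limits taken vertex by vertex. *)
Definition chain N b c : set (nat -> 'rV[R]_d) :=
  [set p | [/\ p 0%N = b, forall i, A (p i) & forall i, (N <= i)%N -> p i = c]].

(* Repeated bisection; the condition relating [beta] to [enorm (c - b)] is
   chosen so that it survives halving [beta]. *)
Lemma chain_ex k b c (beta : R) : A b -> A c -> 0 <= beta ->
  enorm (c - b) * (r + beta) <= r * beta ->
  exists p, chain (2 ^ k) b c p /\ energy (2 ^ k) p <= beta ^+ 2 / (2 ^ k)%:R.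
Proof.
have /andP[r0 reps] := r_eps.
elim: k b c beta => [|k IH] b c beta Ab Ac beta0 hl.
  exists (fun i => if i is 0 then b else c); split.
    by split=> // [[|i]|[|i]].
  rewrite /energy big_ord1 /= invr1 mulr1; apply: enorm_le_sqr.
  have rb : 0 < r + beta by exact: ltr_wpDr.
  rewrite -(ler_pM2r rb); apply: le_trans hl _.
  by have := sqr_ge0 beta; rewrite expr2; lra.
set l := enorm (c - b) in hl.
have l0 : 0 <= l by exact: enorm_ge0.
have lr : l <= r.
  have rb : 0 < r + beta by exact: ltr_wpDr.
  by rewrite -(ler_pM2r rb); apply: le_trans hl _; have := sqr_ge0 r; rewrite expr2; lra.
have mb : enorm (2^-1 *: (b + c) - b) = l / 2.
  have -> : 2^-1 *: (b + c) - b = 2^-1 *: (c - b).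
    by apply/rowP => i; rewrite !mxE; lra.
  by rewrite enormZ ger0_norm ?invr_ge0// mulrC.
have mc : enorm (2^-1 *: (b + c) - c) = l / 2.
  have -> : 2^-1 *: (b + c) - c = - (2^-1 *: (c - b)).
    by apply/rowP => i; rewrite !mxE; lra.
  by rewrite enormN enormZ ger0_norm ?invr_ge0// mulrC.
have [m nm] : exists m, nearest A (2^-1 *: (b + c)) m.
  by apply: (nearest_ex hA Ab); rewrite mb; lra.
have l2r : l <= 2 * r by lra.
have := midpoint_nearest eps_gt0 hA r_eps Ab Ac nm l2r.
rewrite -sqr_enorm -/l; set h := enorm _ => hh.
(* For positive [l] and [beta] the hypothesis reads [1/l - 1/r >= 1/beta]. A length
   [x <= l/2 + l^2/(4r)] has [1/x >= 2/l - 1/r], hence [1/x - 1/r >= 2/beta]. *)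
have half (x : R) : x <= l / 2 + h -> x * (r + beta / 2) <= r * (beta / 2).
  move=> xl.
  have : 4 * r * x <= 2 * r * l + l ^+ 2.
    have : 4 * r * x <= 4 * r * (l / 2 + h) by rewrite ler_pM2l//; lra.
    by move: hh; lra.
  have rb : 0 < 2 * r + beta by rewrite ltr_wpDr// mulr_gt0.
  rewrite -(ler_pM2r rb) => h1.
  have lb : l * (2 * r + beta) <= 2 * (r * beta).
    by have := mulr_ge0 l0 beta0; lra.
  have h2 : l * (l * (2 * r + beta)) <= l * (2 * (r * beta)) by exact: ler_wpM2l.
  have h3 : 4 * r * (l * (r + beta)) <= 4 * r * (r * beta) by rewrite ler_pM2l//; lra.
  have r4 : 0 < 8 * r by lra.
  by rewrite -(ler_pM2l r4); move: h1 h2 h3; lra.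
have b2 : 0 <= beta / 2 by rewrite divr_ge0.
have [|p1 [[p10 p1A p1N] E1]] := IH b m (beta / 2) Ab nm.1 b2.
  apply: half; apply: le_trans (enorm_triangle _ (2^-1 *: (b + c)) _) _.
  by rewrite enormB -/h mb addrC.
have [|p2 [[p20 p2A p2N] E2]] := IH m c (beta / 2) nm.1 Ac b2.
  apply: half; rewrite enormB.
  apply: le_trans (enorm_triangle _ (2^-1 *: (b + c)) _) _.
  by rewrite enormB -/h mc addrC.
(* Concatenation; both pieces take the value [m] at index [2 ^ k]. *)
pose p i := if (i <= 2 ^ k)%N then p1 i else p2 (i - 2 ^ k)%N.
have pr i : p (2 ^ k + i)%N = p2 i.
  rewrite /p addKn; case: i => [|i]; first by rewrite addn0 leqnn p1N// p20.
  by rewrite -[X in (_ <= X)%N]addn0 leq_add2l.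
exists p; split.
  split; first by rewrite /p leq0n.
    by move=> i; rewrite /p; case: ifP.
  move=> i; rewrite expnS mul2n -addnn => ki.
  have -> : i = (2 ^ k + (i - 2 ^ k))%N by rewrite subnKC// (leq_trans _ ki)// leq_addr.
  by rewrite pr p2N// leq_subRL// (leq_trans _ ki)// leq_addr.
rewrite expnS mul2n -addnn /energy big_split_ord /=.
have -> : \sum_(i < 2 ^ k) edot (step p i) (step p i) = energy (2 ^ k) p1.
  by apply: eq_bigr => i _; rewrite /step /p ltn_ord ltnW// ltn_ord.
have -> : \sum_(i < 2 ^ k) edot (step p (2 ^ k + i)%N) (step p (2 ^ k + i)%N) = energy (2 ^ k) p2.
  by apply: eq_bigr => i _; rewrite /step -addnS !pr.
apply: le_trans (lerD E1 E2) _; rewrite natrD.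
have n0 : 0 < (2 ^ k)%:R :> R by rewrite ltr0n expn_gt0.
move: (_%:R) n0 => n n0; rewrite le_eqVlt; apply/orP; left; apply/eqP; field.
by rewrite ?gt_eqF ?addr_gt0.
Qed.

(** Among chains with energy at most that of a given one, each step is bounded by the square root of
    that energy, so every vertex stays bounded and [attains_min] applies. *)
Lemma minimal_chain N b c : chain N b c !=set0 ->
  exists p, chain N b c p /\ forall p', chain N b c p' -> energy N p <= energy N p'.
Proof.
move=> [p0 hp0].
pose S := [set p | chain N b c p /\ energy N p <= energy N p0].
have [||p i||p [[hp Ep] pmin]] := @attains_min R d nat S (energy N) 0
    (fun i => enorm b + i%:R * Num.sqrt (energy N p0)).
- by exists p0.
- by move=> p _; exact: energy_ge0.
- move=> [[p_0 _ pN] Ep].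
  elim: i => [|i IH]; first by rewrite p_0 mul0r addr0.
  rewrite -[p i.+1](subrK (p i)) addrC; apply: le_trans (enormD _ _) _.
  rewrite -natr1 mulrDl mul1r addrA; apply: lerD => //.
  have [iN|Ni] := ltnP i N; last first.
    by rewrite !pN ?subrr ?enorm0 ?sqrtr_ge0// (leq_trans Ni).
  rewrite ler_wsqrtr//; apply: le_trans Ep.
  rewrite /energy (bigD1 (Ordinal iN))//= lerDl.
  by apply: sumr_ge0 => j _; exact: edot_ge0.
- move=> U P p UU SP Pp.
  have cE : (fun n => energy N (P n)) @ U --> energy N p.
    apply: cvg_sumr => i; apply: cvg_edot; apply: cvgB; exact: Pp.
  split=> //; split; last by apply: (cvgr_to_le cE); apply: filterE => n; case: (SP n).
  have const i x : (forall n, P n i = x) -> p i = x.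
    move=> h; have : (fun n => P n i) @ U --> x.
      by rewrite (_ : (fun n => P n i) = cst x); [exact: cvg_cst | apply/funext].
    by move/(norm_cvg_unique (Pp i)).
  split.
  - by apply: const => n; case: (SP n) => -[].
  - by move=> i; apply: (reach_closed eps_gt0 hA (Pp i)) => n; case: (SP n) => -[].
  - by move=> i Ni; apply: const => n; case: (SP n) => -[_ _ ->].
exists p; split=> // p' hp'.
have [le|lt] := leP (energy N p') (energy N p0); first exact: pmin.
exact: le_trans Ep (ltW lt).
Qed.

(** Moving one vertex to [q] changes only two squared steps, whose sum is [2 |q - m|^2] plus a
    constant, with [m] the midpoint of the two neighbours. *)
Lemma minimal_chain_nearest N b c p j : chain N b c p ->
  (forall p', chain N b c p' -> energy N p <= energy N p') -> (j.+1 < N)%N ->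
  nearest A (2^-1 *: (p j + p j.+2)) (p j.+1).
Proof.
move=> [p0 pA pN] pmin jN; split=> // q Aq.
pose p' i := if i == j.+1 then q else p i.
have hp' : chain N b c p'.
  split=> [//|i|i Ni]; rewrite /p'; first by case: ifP.
  by rewrite gtn_eqF ?pN// (leq_trans jN Ni).
have := pmin p' hp'.
rewrite /energy (sum_consecutive (fun i => edot (step p i) (step p i)) jN).
rewrite (sum_consecutive (fun i => edot (step p' i) (step p' i)) jN).
rewrite [X in _ <= _ + _ + X](_ : _ =
  \sum_(i < N | (i != j :> nat) && (i != j.+1 :> nat)) edot (step p i) (step p i)); last first.
  by apply: eq_bigr => i /andP[ij ij1]; rewrite /step /p' eqSS (negPf ij) (negPf ij1).
rewrite lerD2r /step /p' eqxx !eqSS (ltn_eqF (ltnSn j)) (gtn_eqF (ltnSn j)) => h.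
apply: sqr_le_enorm; first exact: enorm_ge0.
rewrite sqr_enorm; move: h; move: (p j) (p j.+1) (p j.+2) => x y z.
rewrite !edotE !(edotC y) !(edotC z) !(edotC q).
by lra.
Qed.

(** The second difference is twice the offset of the vertex from the midpoint of its neighbours,
    which [midpoint_nearest] controls. The energy bound ensures that these neighbours are at
    distance at most [2 r]. *)
Lemma minimal_chain_bend N b c p j : chain N b c p ->
  (forall p', chain N b c p' -> energy N p <= energy N p') -> energy N p <= 2 * r ^+ 2 ->
  (j.+1 < N)%N ->
  r * enorm (step p j.+1 - step p j) <=
    edot (step p j) (step p j) + edot (step p j.+1) (step p j.+1).
Proof.
move=> hp pmin Ep jN; have np := minimal_chain_nearest hp pmin jN.
have [_ pA _] := hp; have /andP[r0 _] := r_eps.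
have dE : p j.+2 - p j = step p j + step p j.+1 by apply/rowP => i; rewrite !mxE; ring.
have d2 : edot (p j.+2 - p j) (p j.+2 - p j) <=
    2 * (edot (step p j) (step p j) + edot (step p j.+1) (step p j.+1)).
  have := edot_ge0 (step p j - step p j.+1).
  by rewrite dE; move: (step p j) (step p j.+1) => u v; rewrite !edotE; lra.
have dr : enorm (p j.+2 - p j) <= 2 * r.
  apply: sqr_le_enorm; first by rewrite mulr_ge0// ltW.
  have : edot (step p j) (step p j) + edot (step p j.+1) (step p j.+1) <= energy N p.
    rewrite /energy (sum_consecutive (fun i => edot (step p i) (step p i)) jN) lerDl.
    by apply: sumr_ge0 => i _; exact: edot_ge0.
  by lra.
have := midpoint_nearest eps_gt0 hA r_eps (pA j) (pA j.+2) np dr.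
have -> : 2^-1 *: (p j + p j.+2) - p j.+1 = 2^-1 *: (step p j.+1 - step p j).
  by apply/rowP => i; rewrite !mxE; lra.
by rewrite enormZ ger0_norm ?invr_ge0//; lra.
Qed.

End Reach.
End Chains.

(** * From minimal chains to a limit curve *)

Section Curve.
Variables (R : realType) (d : nat).
Implicit Types (p : nat -> 'rV[R]_d) (b c q w : 'rV[R]_d).

(* Discrete Taylor expansion of a chain, seen as a graph over the line [R w]. *)
Lemma chain_taylor p w N (h K : R) i j : enorm w = 1 -> 0 < h -> 0 <= K ->
  (forall k, (k < N)%N -> enorm (step p k) <= 5 / 4 * h /\ h / 2 <= edot (step p k) w) ->
  (forall k l, (k <= l)%N -> (l < N)%N ->
     enorm (step p l - step p k) <= (l - k)%:R * (K * h ^+ 2)) ->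
  (i < N)%N -> (j < N)%N ->
  enorm (p j - p i - edot (p j - p i) w *: ((edot (step p i) w)^-1 *: step p i))
    <= 14 * K * edot (p j - p i) w ^+ 2.
Proof.
move=> w1 h0 K0 hstep hbend iN jN.
have [ei ew] := hstep i iN.
set e := step p i in ei ew *; set om := edot e w in ew *.
have om0 : 0 < om by lra.
have Kh : 0 <= K * h ^+ 2 by rewrite mulr_ge0// sqr_ge0.
(* Here [n] is the number of edges between the two vertices and [sg] records their order. *)
suff [n [sg [sg1 [zE zw]]]] : exists (n : nat) (sg : R), sg ^+ 2 = 1 /\
    enorm (p j - p i - (sg * n%:R) *: e) <= n%:R * (n%:R * (K * h ^+ 2)) /\
    n%:R * (h / 2) <= sg * edot (p j - p i) w.
  move: (p j - p i) zE zw => z zE zw.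
  set th := edot z w in zw *.
  have n0 : 0 <= n%:R :> R by rewrite ler0n.
  move: (n%:R : R) n0 zE zw => nr n0 zE zw.
  set B := nr * (nr * (K * h ^+ 2)) in zE *.
  have B0 : 0 <= B by apply: le_trans zE; exact: enorm_ge0.
  have Bth : B <= 4 * K * th ^+ 2.
    have : (nr * (h / 2)) ^+ 2 <= (sg * th) ^+ 2.
      rewrite ler_sqr// ?nnegrE; first by rewrite mulr_ge0// divr_ge0// ltW.
      by apply: le_trans zw; rewrite mulr_ge0// divr_ge0// ltW.
    rewrite [leRHS]exprMn sg1 mul1r => hh.
    have := ler_wpM2l K0 hh.
    by rewrite /B; lra.
  have thE : `|th - (sg * nr) * om| <= B.
    have -> : th - (sg * nr) * om = edot (z - (sg * nr) *: e) w by rewrite edotDl edotNl edotZl.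
    by apply: le_trans (edot_abs_le _ _) _; rewrite w1 mulr1.
  (* With [B <= 4 K th^2], the first part is at most [B] and the second at most [5/2 * B], as
     [|e| / om <= 5/2]; together this gives the constant 14. *)
  have -> : z - th *: (om^-1 *: e) =
      (z - (sg * nr) *: e) - ((th - (sg * nr) * om) / om) *: e.
    rewrite scalerA; apply/rowP => k; rewrite !mxE; field.
    by rewrite gt_eqF.
  apply: le_trans (enormD _ _) _; rewrite enormN enormZ normrM normfV (gtr0_norm om0).
  have : `|th - sg * nr * om| / om * enorm e <= B * (5 / 2).
    have h1 : enorm e / om <= 5 / 2 by rewrite ler_pdivrMr//; lra.
    rewrite -mulrA [om^-1 * _]mulrC; apply: ler_pM => //.
    by rewrite divr_ge0 ?enorm_ge0// ltW.
  by lra.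
have [ij|/ltnW ji] := leqP i j.
  have ik k : (k < j - i)%N -> (i + k < N)%N.
    by move=> kn; apply: leq_ltn_trans jN; rewrite -(subnKC ij) leq_add2l ltnW.
  exists (j - i)%N, 1; rewrite expr1n; split=> //; split.
    rewrite mul1r -{1}(subnKC ij); apply: chain_linear => k kn.
    apply: le_trans (hbend i (i + k)%N (leq_addr _ _) (ik k kn)) _.
    by rewrite addKn (ler_wpM2r Kh)// ler_nat ltnW.
  rewrite mul1r -{2}(subnKC ij) chain_sum (edot_suml _ (fun k => step p (i + k)%N)) mulr_natl.
  rewrite -[X in _ *+ X](card_ord (j - i)) -sumr_const.
  by apply: ler_sum => k _; have [] := hstep (i + k)%N (ik k (ltn_ord k)).
have jk k : (k < i - j)%N -> (j + k <= i)%N.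
  by move=> kn; rewrite -(subnKC ji) leq_add2l ltnW.
exists (i - j)%N, (-1); rewrite sqrrN expr1n; split=> //; split.
  rewrite mulN1r scaleNr opprK -enormN opprD opprB -{1}(subnKC ji).
  apply: chain_linear => k kn; rewrite enormB.
  apply: le_trans (hbend _ _ (jk k kn) iN) _.
  by rewrite (ler_wpM2r Kh)// ler_nat leq_sub2l// leq_addr.
rewrite mulN1r -edotNl opprB -{2}(subnKC ji) chain_sum.
rewrite (edot_suml _ (fun k => step p (j + k)%N)) mulr_natl.
rewrite -[X in _ *+ X](card_ord (i - j)) -sumr_const.
apply: ler_sum => k _.
by have [] := hstep (j + k)%N (leq_ltn_trans (jk k (ltn_ord k)) iN).
Qed.

Section Reach.
Variables (A : set 'rV[R]_d) (eps r : R).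
Hypothesis eps_gt0 : 0 < eps.
Hypothesis hA : unique_nearest A eps.
Hypothesis r_eps : 0 < r < eps.

(* Summing [minimal_chain_bend] bounds the total variation of the steps by the
   energy, so the steps are almost constant, which in turn makes the bound on
   consecutive steps quadratic in the mesh [h]. *)
Lemma regular_chain k b c w (h : R) : A b -> A c -> enorm w = 1 ->
  0 < enorm (c - b) -> 32 * enorm (c - b) <= r ->
  3 / 4 * enorm (c - b) <= edot (c - b) w -> h * (2 ^ k)%:R = enorm (c - b) ->
  exists p, [/\ chain A (2 ^ k) b c p,
    forall i, (i < 2 ^ k)%N -> enorm (step p i) <= 5 / 4 * h /\ h / 2 <= edot (step p i) w &
    forall i j, (i <= j)%N -> (j < 2 ^ k)%N ->
      enorm (step p j - step p i) <= (j - i)%:R * (4 / r * h ^+ 2)].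
Proof.
move=> Ab Ac w1; set l := enorm (c - b) => l0 lr lw hl.
have /andP[r0 reps] := r_eps.
have n0 : 0 < (2 ^ k)%:R :> R by rewrite ltr0n expn_gt0.
have n1 : 1 <= (2 ^ k)%:R :> R by rewrite ler1n expn_gt0.
have h0 : 0 < h by rewrite -(pmulr_lgt0 _ n0) hl.
(* [chain_ex] with [beta = 2 l], admissible because [2 l <= r]. *)
have [p0 [hp0 Ep0]] : exists p, chain A (2 ^ k) b c p /\
    energy (2 ^ k) p <= (2 * l) ^+ 2 / (2 ^ k)%:R.
  apply: (chain_ex eps_gt0 hA r_eps) => //; first by rewrite mulr_ge0// ltW.
  rewrite -/l -subr_ge0.
  have -> : r * (2 * l) - l * (r + 2 * l) = l * (r - 2 * l) by ring.
  by rewrite mulr_ge0 ?(ltW l0)//; lra.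
have [p [hp pmin]] := minimal_chain eps_gt0 hA (ex_intro _ p0 hp0).
have Ep : energy (2 ^ k) p <= 4 * l * h.
  apply: le_trans (pmin _ hp0) _; apply: le_trans Ep0 _.
  by rewrite -hl ler_pdivrMr//; lra.
have hll : h <= l by rewrite -hl ler_peMr// ltW.
have lh : l * h <= l * l by rewrite ler_pM2l.
have llr : l * l <= r ^+ 2 / 32.
  by have : l * (32 * l) <= l * r by [rewrite ler_pM2l];
  have : l * r <= r * r by [rewrite ler_pM2r//; lra]; lra.
have Er : energy (2 ^ k) p <= 2 * r ^+ 2 by have := sqr_ge0 r; lra.
have bend j := minimal_chain_bend eps_gt0 hA r_eps hp pmin Er (j := j).
pose a i := edot (step p i) (step p i).
have a0 i : 0 <= a i by exact: edot_ge0.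
(* The total variation of the steps is at most [2/r] times the energy, hence at most
   [8 l h / r <= h / 4]. *)
have close i j : (i <= j)%N -> (j < 2 ^ k)%N -> enorm (step p j - step p i) <= h / 4.
  move=> ij jN.
  pose T j := r^-1 * \sum_(m < j) (a m + a m.+1).
  have h1 m : (m.+1 < 2 ^ k)%N -> enorm (step p m.+1 - step p m) <= T m.+1 - T m.
    move=> mN; rewrite /T big_ord_recr /= -mulrBr.
    rewrite [X in _ * X](_ : _ = a m + a m.+1); last by ring.
    by rewrite ler_pdivlMl//; exact: bend.
  apply: le_trans (telescope_le h1 ij jN) _.
  have s0 (n : nat) : 0 <= r^-1 * \sum_(m < n) (a m + a m.+1).
    rewrite mulr_ge0 ?invr_ge0 ?(ltW r0)//; apply: sumr_ge0 => m _.
    by rewrite addr_ge0.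
  apply: (@le_trans _ _ (r^-1 * \sum_(m < j) (a m + a m.+1))).
    by rewrite /T gerBl; exact: s0.
  have sub n : (n <= 2 ^ k)%N -> \sum_(m < n) a m <= energy (2 ^ k) p.
    move=> nN; rewrite /energy -/(a _) -(subnKC nN) big_split_ord /= lerDl.
    by apply: sumr_ge0 => m _; exact: a0.
  have : \sum_(m < j) (a m + a m.+1) <= 2 * energy (2 ^ k) p.
    rewrite big_split /=; have := sub j (ltnW jN); have := sub j.+1 jN.
    by rewrite big_ord_recl /=; have := a0 0%N; rewrite /bump /=; lra.
  rewrite ler_pdivrMl// => hs; apply: le_trans hs _.
  have : h * (32 * l) <= h * r by rewrite ler_pM2l.
  by lra.
have close' i j : (i < 2 ^ k)%N -> (j < 2 ^ k)%N -> enorm (step p j - step p i) <= h / 4.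
  move=> iN jN; have [ij|/ltnW ji] := leqP i j; first exact: close.
  by rewrite enormB; exact: close.
have [pb _ pc] := hp.
(* The steps add up to [c - b], so each is within [h / 4] of the mean step, which has length [h] and
   component at least [3/4 * h] along [w]. *)
have steps i : (i < 2 ^ k)%N -> enorm (step p i) <= 5 / 4 * h /\ h / 2 <= edot (step p i) w.
  move=> iN.
  have := @chain_linear _ _ p 0 (2 ^ k) (step p i) (h / 4) _.
  move=> /(_ (fun m mN => close' i m iN mN)); rewrite add0n pb pc//.
  have -> : (2 ^ k)%:R * (h / 4) = l / 4 by rewrite -hl; lra.
  move: (c - b) @l (step p i) lw hl {lr l0 hll lh llr Ep Ep0} => v l e lw hl ve; split.
    rewrite -(ler_pM2l n0) -{1}(gtr0_norm n0) -enormZ.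
    rewrite -[_ *: e](_ : v - (v - (2 ^ k)%:R *: e) = _); last by rewrite opprB addrC subrK.
    by apply: le_trans (enormD _ _) _; rewrite enormN -/l; lra.
  have /ler_normlP[_] : `|edot (v - (2 ^ k)%:R *: e) w| <= l / 4.
    by apply: le_trans (edot_abs_le _ _) _; rewrite w1 mulr1.
  by rewrite edotDl edotNl edotZl => hh; rewrite -(ler_pM2l n0); lra.
exists p; split=> // i j ij jN.
have := @telescope_le _ _ (step p) (fun j => j%:R * (4 / r * h ^+ 2)) (2 ^ k) i j _ ij jN.
rewrite -mulrBl -natrB//; apply => m mN.
rewrite -natr1 -mulrBl [X in _ <= X * _](_ : _ = 1) ?mul1r; last by ring.
(* Step lengths at most [5/4 * h] put back into [bend] give a right-hand side below [4 h^2]. *)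
have /enorm_le_sqr s1 := (steps m (ltnW mN)).1.
have /enorm_le_sqr s2 := (steps m.+1 mN).1.
rewrite mulrAC ler_pdivlMr// mulrC; apply: le_trans (bend m mN) _.
by have := sqr_ge0 h; lra.
Qed.

(** For each abscissa [t] take an edge whose projection to the line contains [t]: [G t] is its first
    vertex and [g t] its direction, scaled to have component 1 along [w]. The constant 56 is 14 from
    [chain_taylor] times 4 from [regular_chain]. *)
Lemma discrete_curve k b c w (h : R) : A b -> A c -> enorm w = 1 ->
  0 < enorm (c - b) -> 32 * enorm (c - b) <= r ->
  3 / 4 * enorm (c - b) <= edot (c - b) w -> h * (2 ^ k)%:R = enorm (c - b) ->
  exists G g : R -> 'rV[R]_d,
    (forall t, edot b w <= t <= edot c w ->
      [/\ A (G t), `|edot (G t) w - t| <= 5 / 4 * h, edot (g t) w = 1,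
          enorm (g t) <= 5 / 2 & enorm (G t - b) <= 5 / 4 * enorm (c - b)]) /\
    (forall s t, edot b w <= s <= edot c w -> edot b w <= t <= edot c w ->
      enorm (G s - G t - edot (G s - G t) w *: g t) <= 56 / r * edot (G s - G t) w ^+ 2).
Proof.
move=> Ab Ac w1 l0 lr lw hl; have /andP[r0 _] := r_eps.
have [p [[pb pA pc] steps bend]] := regular_chain Ab Ac w1 l0 lr lw hl.
have n0 : 0 < (2 ^ k)%:R :> R by rewrite ltr0n expn_gt0.
have h0 : 0 < h by rewrite -(pmulr_lgt0 _ n0) hl.
have /choice[f hf] : forall t, exists i, edot b w <= t <= edot c w ->
    (i < 2 ^ k)%N /\ edot (p i) w <= t <= edot (p i.+1) w.
  move=> t; have [tbc|nt] := pselect (edot b w <= t <= edot c w); last by exists 0%N.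
  have [||i hi] := @discrete_ivt _ (fun i => edot (p i) w) (2 ^ k) t.
  - by rewrite expn_gt0.
  - by rewrite pb pc.
  - by exists i.
exists (fun t => p (f t)), (fun t => (edot (step p (f t)) w)^-1 *: step p (f t)); split.
  move=> t /hf[iN /andP[pt tp]]; have [e1 e2] := steps _ iN.
  have om0 : 0 < edot (step p (f t)) w by lra.
  split=> //.
  - have : edot (step p (f t)) w <= 5 / 4 * h.
      by apply: le_trans (edot_le _ _) _; rewrite w1 mulr1.
    by rewrite ler_norml /step !edotE; lra.
  - by rewrite edotZl mulVf// gt_eqF.
  - rewrite enormZ normfV (gtr0_norm om0) ler_pdivrMl//; lra.
  - have := chain_sum p 0 (f t); rewrite add0n pb => ->.
    apply: le_trans (enorm_sum (f t) (fun i => step p (0 + i))) _.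
    apply: (@le_trans _ _ ((f t)%:R * (5 / 4 * h))).
      rewrite mulr_natl -[X in _ *+ X](card_ord (f t)) -sumr_const.
      apply: ler_sum => m _; rewrite add0n.
      by have [] := steps m (ltn_trans (ltn_ord m) iN).
    rewrite -hl mulrC mulrA ler_pM2l; last by lra.
    by rewrite ler_nat ltnW.
move=> s t /hf[sN _] /hf[tN _].
have -> : 56 / r = 14 * (4 / r) by field; rewrite gt_eqF.
apply: (chain_taylor w1 h0 _ steps bend tN sN).
by rewrite divr_ge0// ltW.
Qed.

(** As the mesh tends to 0, [G k t] and [g k t] converge for all [t] along one ultrafilter; the
    error in the abscissa vanishes and the Taylor inequality passes to the limit. Outside the
    interval the value 0 is arbitrary. *)
Lemma curve_ex b c w : A b -> A c -> enorm w = 1 ->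
  0 < enorm (c - b) -> 32 * enorm (c - b) <= r ->
  3 / 4 * enorm (c - b) <= edot (c - b) w ->
  exists G g : R -> 'rV[R]_d,
    (forall t, edot b w <= t <= edot c w ->
      [/\ A (G t), edot (G t) w = t, edot (g t) w = 1 &
          enorm (G t - b) <= 5 / 4 * enorm (c - b)]) /\
    (forall s t, edot b w <= s <= edot c w -> edot b w <= t <= edot c w ->
      enorm (G s - G t - (s - t) *: g t) <= 56 / r * (s - t) ^+ 2).
Proof.
move=> Ab Ac w1 l0 lr lw; set l := enorm (c - b) in l0 lr lw *.
pose h k : R := l / (2 ^ k)%:R.
have hl k : h k * (2 ^ k)%:R = l.
  by rewrite /h mulfVK// pnatr_eq0 -lt0n expn_gt0.
have [G hG] := choice (fun k => discrete_curve Ab Ac w1 l0 lr lw (hl k)).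
have [g GgP] := choice hG.
have [U [UU sU]] := ultraFilterLemma (eventually_filter).
pose dom (t : R) := edot b w <= t <= edot c w.
have /choice[G0 G0P] : forall t : R, exists x : 'rV[R]_d, dom t -> (fun k => G k t) @ U --> x.
  move=> t; have [td|nt] := pselect (dom t); last by exists 0.
  have [k|x hx] := @ultra_bounded_cvg _ _ _ U UU (G ^~ t) (5 / 4 * l + enorm b).
    have [/(_ t td)[_ _ _ _ hb] _] := GgP k.
    rewrite -[G k t](subrK b); apply: le_trans (enormD _ _) _.
    by rewrite lerD2r.
  by exists x.
have /choice[g0 g0P] : forall t : R, exists x : 'rV[R]_d, dom t -> (fun k => g k t) @ U --> x.
  move=> t; have [td|nt] := pselect (dom t); last by exists 0.
  have [k|x hx] := @ultra_bounded_cvg _ _ _ U UU (g ^~ t) (5 / 2).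
    by have [/(_ t td)[_ _ _ hb _] _] := GgP k.
  by exists x.
have h_lim : (fun k => 5 / 4 * h k) @ U --> 0.
  rewrite -[X in _ --> X](mulr0 (5 / 4)); apply: cvgM; first exact: cvg_cst.
  apply: cvg_trans (_ : h @ \oo --> 0) => [B /sU //|].
  rewrite -[X in _ --> X](mulr0 l); apply: cvgM; first exact: cvg_cst.
  rewrite (_ : (fun k => _) = (fun k => 2^-1 ^+ k)); last first.
    by apply/funext => k; rewrite natrX exprVn.
  by apply: cvg_expr; rewrite ger0_norm ?invr_ge0// invf_lt1// ltr1n.
have Gw t : dom t -> (fun k => edot (G k t) w) @ U --> t.
  move=> td; apply/cvgrPdist_le => e e0.
  move/cvgrPdist_le : h_lim => /(_ _ e0); apply: filterS => k.
  rewrite sub0r normrN distrC; apply: le_trans; apply: le_trans (ler_norm _).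
  by have [/(_ t td)[]] := GgP k.
exists G0, g0; split.
  move=> t td; split.
  - by apply: (reach_closed eps_gt0 hA (G0P t td)) => k; have [/(_ t td)[]] := GgP k.
  - have : (fun k => edot (G k t) w) @ U --> edot (G0 t) w.
      by apply: cvg_edot; [exact: G0P | exact: cvg_cst].
    by move/(norm_cvg_unique (Gw t td)) => <-.
  - have : (fun k => edot (g k t) w) @ U --> edot (g0 t) w.
      by apply: cvg_edot; [exact: g0P | exact: cvg_cst].
    have : (fun k => edot (g k t) w) @ U --> (1 : R).
      rewrite (_ : (fun k => _) = cst 1); first exact: cvg_cst.
      by apply/funext => k; have [/(_ t td)[]] := GgP k.
    by move=> h1 /(norm_cvg_unique h1) <-.
  - apply: (cvgr_to_le (f := fun k => enorm (G k t - b)) (F := U)).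
      by apply: cvg_enorm; apply: cvgB; [exact: G0P | exact: cvg_cst].
    by apply: filterE => k; have [/(_ t td)[]] := GgP k.
move=> s t sd td.
have cth : (fun k => edot (G k s - G k t) w) @ U --> s - t.
  rewrite (_ : (fun k => _) = (fun k => edot (G k s) w - edot (G k t) w)).
    by apply: cvgB; exact: Gw.
  by apply/funext => k; rewrite !edotE.
apply: (ler_cvg_to (a := U)
  (f := fun k => enorm (G k s - G k t - edot (G k s - G k t) w *: g k t))
  (g := fun k => 56 / r * edot (G k s - G k t) w ^+ 2)).
- apply: cvg_enorm; apply: cvgB; first by apply: cvgB; exact: G0P.
  by apply: cvgZ => //; exact: g0P.
- by apply: cvgM; [exact: cvg_cst | rewrite expr2; apply: cvgM].
- by apply: filterE => k; have [_] := GgP k; apply.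
Qed.

End Reach.
End Curve.

(** * The curve *)

Section C11.
Variables (R : realType) (d : nat).
Implicit Types (f g : R -> 'rV[R]_d).

Lemma taylor_derive f g (C : R) :
  (forall s t, enorm (f s - f t - (s - t) *: g t) <= C * (s - t) ^+ 2) ->
  forall t, derivable f t 1 /\ derive1 f t = g t.
Proof.
move=> taylor t.
have c : h^-1 *: ((f \o shift t) (h *: (1 : R)) - f t) @[h --> 0^'] --> g t.
  have cC : (fun h : R => C * `|h|) @ 0^' --> 0.
    rewrite -[X in _ --> X](mulr0 C); apply: cvgM; first exact: cvg_cst.
    rewrite -[X in _ --> X](@normr0 _ R); apply: cvg_norm.
    exact: (@cvg_within _ (nbhs (0 : R))).
  apply: (enorm_cvg cC); near=> h.
  have h0 : h != 0 by near: h; exact: nbhs_dnbhs_neq.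
  rewrite /= enormB [h *: 1]mulr1.
  have -> : h^-1 *: (f (h + t) - f t) - g t = h^-1 *: (f (h + t) - f t - (h + t - t) *: g t).
    by rewrite addrK [in RHS]scalerBr scalerA mulVf// scale1r.
  rewrite enormZ normfV ler_pdivrMl ?normr_gt0//.
  apply: le_trans (taylor _ _) _; rewrite addrK -(real_normK (num_real h)); lra.
split; first exact: cvgP c.
by rewrite derive1E; exact: cvg_lim c.
Unshelve. all: by end_near. Qed.

(** Adding the expansions at [s] and at [t] cancels [f] and leaves [(s - t) (g s - g t)]. *)
Lemma taylor_lipschitz f g (C : R) s t :
  enorm (f s - f t - (s - t) *: g t) <= C * (s - t) ^+ 2 ->
  enorm (f t - f s - (t - s) *: g s) <= C * (t - s) ^+ 2 ->
  enorm (g s - g t) <= 2 * C * `|s - t|.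
Proof.
have [->|st] := eqVneq s t; first by rewrite !subrr enorm0 normr0 mulr0.
move=> h1 h2; have st0 : 0 < `|s - t| by rewrite normr_gt0 subr_eq0.
rewrite -(ler_pM2l st0) -enormZ.
have -> : (s - t) *: (g s - g t) =
    (f s - f t - (s - t) *: g t) + (f t - f s - (t - s) *: g s).
  by apply/rowP => i; rewrite !mxE; ring.
apply: le_trans (enormD _ _) _; apply: le_trans (lerD h1 h2) _.
have -> : (t - s) ^+ 2 = (s - t) ^+ 2 by ring.
by rewrite -(real_normK (num_real (s - t))); lra.
Qed.

Definition clamp (l r t : R) : R := Num.min r (Num.max l t).

Lemma clampP (l r t : R) : l <= r -> l <= clamp l r t <= r.
Proof. by move=> lr; rewrite /clamp ge_min lexx le_min lr le_max lexx. Qed.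

Lemma clamp_id (l r t : R) : l <= t <= r -> clamp l r t = t.
Proof. by move=> /andP[lt tr]; rewrite /clamp max_r// min_r. Qed.

Lemma clamp_cases (l r t : R) : l <= r ->
  [\/ t <= l /\ clamp l r t = l, l <= t <= r /\ clamp l r t = t |
      r <= t /\ clamp l r t = r].
Proof.
move=> lr; have [tl|/ltW lt] := leP t l.
  by apply: Or31; rewrite /clamp max_l// min_r.
have [tr|/ltW rt] := leP t r; first by apply: Or32; rewrite clamp_id ?lt.
by apply: Or33; rewrite /clamp max_r// min_l.
Qed.

(** Projection to an interval is 1-Lipschitz. In the second bound the product vanishes unless [s]
    lies outside the interval and [t] does not lie beyond the same end; then both factors are at
    most [|s - t|]. *)
Lemma clamp_sqr (l r s t : R) : l <= r ->
  (clamp l r s - clamp l r t) ^+ 2 <= (s - t) ^+ 2 /\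
  `|s - clamp l r s| * `|clamp l r s - clamp l r t| <= (s - t) ^+ 2.
Proof.
move=> lr; rewrite -normrM.
case: (clamp_cases s lr) => -[hs ->]; case: (clamp_cases t lr) => -[ht ->];
  rewrite ?(andP hs) ?subrr ?mulr0 ?mul0r ?normr0 ?expr0n /= ?sqr_ge0 ?lexx;
  (split; first by nra); rewrite // ler_norml; apply/andP; split; nra.
Qed.

(** The curve is continued by its tangent lines at both ends, so its derivative becomes [g] composed
    with [clamp]. The factor 3 is 1 from the expansion plus 2 from the Lipschitz bound on [g]. *)
Lemma taylor_extend f g (C l r : R) : l <= r -> 0 <= C ->
  (forall s t, l <= s <= r -> l <= t <= r ->
    enorm (f s - f t - (s - t) *: g t) <= C * (s - t) ^+ 2) ->
  let F t := f (clamp l r t) + (t - clamp l r t) *: g (clamp l r t) in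
  forall s t, enorm (F s - F t - (s - t) *: g (clamp l r t)) <= 3 * C * (s - t) ^+ 2.
Proof.
move=> lr C0 taylor F s t; rewrite /F.
have [d1 d2] := clamp_sqr s t lr.
set x := clamp l r s in d1 d2 *; set y := clamp l r t in d1 d2 *.
have hx : l <= x <= r by exact: clampP.
have hy : l <= y <= r by exact: clampP.
have -> : f x + (s - x) *: g x - (f y + (t - y) *: g y) - (s - t) *: g y =
    (f x - f y - (x - y) *: g y) + (s - x) *: (g x - g y).
  by apply/rowP => i; rewrite !mxE; ring.
apply: le_trans (enormD _ _) _; rewrite enormZ.
have h1 := taylor x y hx hy; have h2 := taylor y x hy hx.
have h3 := taylor_lipschitz h1 h2.
have h4 : `|s - x| * enorm (g x - g y) <= `|s - x| * (2 * C * `|x - y|) by exact: ler_wpM2l.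
have h5 := ler_wpM2l C0 d1; have h6 := ler_wpM2l C0 d2.
by lra.
Qed.

(** Used with [u = x - a], [v = q - x], and [w], [w'] the tangent directions at [a] and [x]. As [u]
    is nearly parallel to both [w] and [w'], orthogonality to [w] forces [|<v, w'>| <= |v| / 2],
    while the parabola at [x] gives [|perp w' v| <= |v| / 2]; by Pythagoras [v = 0]. *)
Lemma parabola_unique (w w' u v : 'rV[R]_d) (r : R) : enorm w = 1 -> enorm w' = 1 ->
  0 < r -> edot v w = 0 -> 4 * enorm u <= r -> enorm v <= r ->
  2 * r * enorm (perp w u) <= edot u u -> 2 * r * enorm (perp w' u) <= edot u u ->
  2 * r * enorm (perp w' v) <= edot v v -> u != 0 -> v = 0.
Proof.
move=> w1 w'1 r0 vw ur vr h1 h2 h3 u0.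
have un := enorm_gt0 u0; have vn := enorm_ge0 v.
set U := enorm u in ur un *; set N := enorm v in vr vn *.
have uE : edot u u = U ^+ 2 by rewrite -sqr_enorm.
have vE : edot v v = N ^+ 2 by rewrite -sqr_enorm.
have pyth x : edot x x = edot x w' ^+ 2 + enorm (perp w' x) ^+ 2.
  by rewrite sqr_enorm /perp !edotE (edotC w' x) -[edot w' w']sqr_enorm w'1; ring.
rewrite uE in h1 h2; rewrite vE in h3.
have k1 : `|edot v u| * (2 * r) <= N * U ^+ 2.
  have : `|edot v u| <= N * enorm (perp w u).
    by rewrite -(edot_perp u vw); exact: edot_abs_le.
  by have := ler_wpM2l vn h1; nra.
have k2 : `|edot v (perp w' u)| * (2 * r) <= N * U ^+ 2.
  have : `|edot v (perp w' u)| <= N * enorm (perp w' u) by exact: edot_abs_le.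
  by have := ler_wpM2l vn h2; nra.
have k3 : edot v (perp w' u) = edot v u - edot u w' * edot v w'.
  by rewrite /perp edotDr edotNr edotZr.
have k4 : `|edot u w'| * `|edot v w'| * r <= N * U ^+ 2.
  rewrite -normrM.
  have : `|edot u w' * edot v w'| <= `|edot v u| + `|edot v (perp w' u)|.
    rewrite k3 -[X in `|X| <= _](_ : edot v u - (edot v u - edot u w' * edot v w') = _);
      last by ring.
    exact: ler_normB.
  by move: k1 k2; nra.
have k5 : U / 2 <= `|edot u w'|.
  have p1 : enorm (perp w' u) <= U / 8.
    have r2 : 0 < 2 * r by lra.
    rewrite -(ler_pM2l r2); apply: le_trans h2 _.
    by have : U * (4 * U) <= U * r by [rewrite ler_pM2l]; lra.
  have p2 : enorm (perp w' u) ^+ 2 <= (U / 8) ^+ 2.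
    by rewrite ler_sqr ?nnegrE ?enorm_ge0// divr_ge0// ltW.
  have : (U / 2) ^+ 2 <= `|edot u w'| ^+ 2.
    rewrite real_normK ?num_real//; have := pyth u; rewrite uE.
    by have := sqr_ge0 U; lra.
  by rewrite ler_sqr ?nnegrE// divr_ge0// ltW.
have k6 : `|edot v w'| <= N / 2.
  have : U / 2 * `|edot v w'| * r <= N * U ^+ 2.
    by apply: le_trans k4; rewrite ler_pM2r// ler_wpM2r.
  have : N * (U * (4 * U)) <= N * (U * r) by rewrite ler_wpM2l// ler_pM2l.
  have ur0 : 0 < U * r by rewrite mulr_gt0.
  by rewrite -[in X in _ -> _ -> X](ler_pM2l ur0); lra.
have k7 : enorm (perp w' v) <= N / 2.
  have r2 : 0 < 2 * r by lra.
  rewrite -(ler_pM2l r2); apply: le_trans h3 _.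
  by have : N * N <= N * r by [rewrite ler_wpM2l]; lra.
have k8 : enorm (perp w' v) ^+ 2 <= (N / 2) ^+ 2.
  by rewrite ler_sqr ?nnegrE ?enorm_ge0// divr_ge0.
have k9 : edot v w' ^+ 2 <= (N / 2) ^+ 2.
  by rewrite -(real_normK (num_real (edot v w'))) ler_sqr ?nnegrE// divr_ge0.
have := pyth v; rewrite vE => E.
apply: edot_eq0; rewrite vE; apply/eqP; rewrite eq_le sqr_ge0 andbT.
by lra.
Qed.

End C11.

(** * The curve near a point with a full tangent line *)

Theorem theorem4p4 (R : realType) (d : nat) (hd : (2 <= d)%N)
  (A : set 'rV[R]_d) (a : 'rV[R]_d) :
  positive_reach A -> T1plus A a ->
  exists (G : set 'rV[R]_d) (delta : R),
    C11_surface1 G /\ 0 < delta /\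
    T1 A `&` eball a delta `<=` G `&` eball a delta /\
    G `&` eball a delta `<=` A.
Proof.
move=> [eps [eps0 hA]] a1; pose r := eps / 2.
have r0 : 0 < r by rewrite divr_gt0.
have reps : 0 < r < eps by rewrite r0 /r; lra.
have Aa : A a by case: a1 => -[].
have [w [w1 Tw]] := T1plus_line a1.
have Tw' : Tan A a `<=` line w by rewrite Tw.
(* Two points this close to [a] satisfy [32 |c - b| <= r]. As the tangent cone is the full line,
   they can be taken in the directions [w] and [- w]. *)
have e0 : 0 < r / 128 by rewrite divr_gt0.
have [c [Ac ca cr cw]] : exists q, [/\ A q, q != a, enorm (q - a) < r / 128 &
    3 / 4 * enorm (q - a) <= edot (q - a) w].
  by apply: Tan_direction => //; rewrite Tw; exists 1; rewrite ?scale1r.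
have [b [Ab ba br bw]] : exists q, [/\ A q, q != a, enorm (q - a) < r / 128 &
    3 / 4 * enorm (q - a) <= edot (q - a) (- w)].
  apply: Tan_direction; rewrite ?enormN//.
  by rewrite Tw; exists (-1); rewrite ?scaleN1r.
have c0 : 0 < enorm (c - a) by rewrite enorm_gt0// subr_eq0.
have b0 : 0 < enorm (b - a) by rewrite enorm_gt0// subr_eq0.
have cbE : c - b = (c - a) - (b - a) by rewrite opprB addrA subrK.
have cb_le : enorm (c - b) <= enorm (c - a) + enorm (b - a).
  by rewrite cbE -[enorm (b - a)]enormN; exact: enormD.
have cb_dot : edot (c - b) w = edot (c - a) w - edot (b - a) w.
  by rewrite cbE edotDl edotNl.
rewrite edotNr in bw.
have cbw : 3 / 4 * enorm (c - b) <= edot (c - b) w by rewrite cb_dot; lra.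
have cb0 : 0 < enorm (c - b).
  have : edot (c - b) w <= enorm (c - b).
    by apply: le_trans (edot_le _ _) _; rewrite w1 mulr1.
  by rewrite cb_dot; lra.
have cbr : 32 * enorm (c - b) <= r by lra.
have [gam [g [gamP taylor]]] := curve_ex eps0 hA reps Ab Ac w1 cb0 cbr cbw.
pose l := edot b w; pose m := edot c w.
have la : l < edot a w by move: bw; rewrite edotDl edotNl -/l; lra.
have am : edot a w < m by move: cw; rewrite edotDl edotNl -/m; lra.
have lm : l <= m by lra.
have C0 : 0 <= 56 / r by rewrite divr_ge0// ltW.
(* A surface needs [psi] on the whole line, while [gam] is controlled only on [[l, m]]. *)
have := taylor_extend lm C0 taylor.
set F := fun t => _ => F_taylor; rewrite /= in F_taylor.
have Fw t : edot (F t) w = t.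
  have := gamP _ (clampP t lm) => -[_ E1 E2 _].
  by rewrite /F edotDl edotZl E1 E2; ring.
have F_gam t : l <= t <= m -> F t = gam t.
  by move=> tlm; rewrite /F clamp_id// subrr scale0r addr0.
pose psi t := F t - t *: w.
have psi_taylor s t : enorm (psi s - psi t - (s - t) *: (g (clamp l m t) - w))
    <= 3 * (56 / r) * (s - t) ^+ 2.
  rewrite (_ : psi s - _ - _ = F s - F t - (s - t) *: g (clamp l m t)); first exact: F_taylor.
  by rewrite /psi; move: (F s) (F t) => x y; apply/rowP => i; rewrite !mxE; ring.
have psi_derive := taylor_derive psi_taylor.
have psiE t : t *: w + psi t = F t by rewrite addrC subrK.
(* The last two bounds keep abscissas in [[l, m]], where [F] equals [gam]; [r / 4] is the bound on
   [u] in [parabola_unique]. *)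
pose delta := Num.min (r / 4) (Num.min (edot a w - l) (m - edot a w)).
have in_range x : eball a delta x -> l <= edot x w <= m /\ enorm (x - a) < r / 4.
  rewrite /eball /= !lt_min => /and3P[xr xl xm]; split=> //.
  have /ler_normlP[] : `|edot (x - a) w| <= enorm (x - a).
    by apply: le_trans (edot_abs_le _ _) _; rewrite w1 mulr1.
  by rewrite edotDl edotNl; lra.
exists [set t *: w + psi t | t in [set: R]], delta; split; last split; last split.
- exists w, psi; split=> //; split.
    by move=> t; rewrite /psi edotDl edotNl edotZl Fw -sqr_enorm w1; ring.
  split; first by move=> t; case: (psi_derive t).
  split=> //; exists (2 * (3 * (56 / r))) => s t.
  rewrite (psi_derive s).2 (psi_derive t).2.
  exact: (@taylor_lipschitz _ _ psi (fun t => g (clamp l m t) - w)).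
- by rewrite !lt_min divr_gt0// !subr_gt0 la am.
- move=> x [x1 xB]; split=> //; exists (edot x w) => //; rewrite psiE.
  have [xlm xr] := in_range x xB; rewrite F_gam//.
  have [Aq qw _ qb] := gamP _ xlm.
  set q := gam _ in Aq qw qb *.
  have [w' [w'1 Tx]] := T1_line x1; have Ax : A x by case: x1.
  have vw : edot (q - x) w = 0 by rewrite edotDl edotNl qw subrr.
  have vr : enorm (q - x) <= r.
    have := enorm_triangle q b x; have := enorm_triangle b a x.
    by rewrite (enormB a x); lra.
  suff /eqP : q - x = 0 by rewrite subr_eq0 => /eqP.
  (* If [x = a], then [q - a] is orthogonal to [w] and the parabola at [a] alone gives
     [2 r |q - a| <= |q - a|^2], so [q = a] because [|q - a| <= r]. *)
  have [xa|xa] := eqVneq (x - a) 0.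
    have := parabola eps0 hA reps Aa Tw' w1 Aq.
    have {xa} <- : x = a by apply/eqP; rewrite -subr_eq0; exact/eqP.
    rewrite /perp vw scale0r subr0 -sqr_enorm => h.
    have [//|v0] := eqVneq (q - x) 0; have vn := enorm_gt0 v0.
    by exfalso; move: h; rewrite expr2 ler_pM2r//; lra.
  apply: (parabola_unique w1 w'1 r0 vw _ vr (parabola eps0 hA reps Aa Tw' w1 Ax) _
    (parabola eps0 hA reps Ax Tx w'1 Aq) xa); first by lra.
  have := parabola eps0 hA reps Ax Tx w'1 Aa.
  by rewrite -(opprB x a) -scaleN1r perpZ !scaleN1r enormN edotNl edotNr opprK.
- move=> _ [[t _ <-]]; rewrite psiE => /in_range[]; rewrite Fw => tlm _.
  by rewrite F_gam//; case: (gamP _ tlm).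
Qed.
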